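(* Let $q$ be an odd prime power, let $m=4t+2\ge2$ for an integer $t\ge0$, and let $n=q^{m}+1$. Then: (1) For every integer $\delta$ with $\delta_{3,n}+1\le\delta\le\delta_{2,n}$, the code $\mathcal{C}_{(n,q,\delta,1)}$ is an LCD code with parameters $[n,6,d\ge\delta_{3,n}]$; for every integer $\delta$ with $\delta_{4,n}+1\le\delta\le\delta_{3,n}$, it is an LCD code with parameters $[n,2m+6,d\ge\delta_{4,n}]$. (2) For every integer $\delta$ with $\delta_{3,n}+1\le\delta\le\delta_{2,n}$, the code $\mathcal{C}_{(n,q,\delta+1,0)}$ is an LCD code with parameters $[n,5,d\ge2\delta_{3,n}]$; for every integer $\delta$ with $\delta_{4,n}+1\le\delta\le\delta_{3,n}$, it is an LCD code with parameters $[n,2m+5,d\ge2\delta_{4,n}]$.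
   Context: Let $q$ be a prime power and $n\ge2$ an integer with $\gcd(n,q)=1$. Let $\ell=\mathrm{ord}_n(q)$, let $\alpha$ be a generator of $\mathbb{F}_{q^\ell}^*$, $\beta=\alpha^{(q^\ell-1)/n}$, and let $m_i(x)$ be the minimal polynomial of $\beta^i$ over $\mathbb{F}_q$. For integers $b\ge0$ and $2\le\delta\le n$, $\mathcal{C}_{(n,q,\delta,b)}$ denotes the cyclic code of length $n$ over $\mathbb{F}_q$ with generator polynomial $\mathrm{lcm}(m_b(x),\dots,m_{b+\delta-2}(x))$. A linear code $\mathcal{C}$ is LCD if $\mathcal{C}\cap\mathcal{C}^{\perp}=\{0\}$ (Euclidean dual). $[n,k,d\ge D]$ means length $n$, dimension $k$, minimum Hamming distance at least $D$. For $0\le s\le n-1$, $C_s=\{sq^i\bmod n:0\le i\le\ell-1\}$ is the $q$-cyclotomic coset of $s$ modulo $n$; its least element is its coset leader; $\mathrm{MinRep}_n$ is the set of all coset leaders modulo $n$ (including $0$), and $\delta_{i,n}$ is the $i$-th largest element of $\mathrm{MinRep}_n$. *)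

(* Defs.v *)
From HB Require Import structures.
From mathcomp Require Import all_boot all_order all_algebra all_field.
Set Implicit Arguments. Unset Strict Implicit. Unset Printing Implicit Defensive.
Import GRing.Theory.
Local Open Scope ring_scope.

(* ord_n(q): the least k >= 1 with q^k = 1 mod n (searched in 1..n; when
   gcd(n,q)=1 and n >= 2 the order is <= phi(n) < n, so it is found). *)
Definition ordn (n q : nat) : nat :=
  head 0%N [seq k <- iota 1 n | (q ^ k %% n == 1 %% n)%N].

Definition cyc_coset (n q s : nat) : seq nat :=
  [seq (s * q ^ i %% n)%N | i <- iota 0 (ordn n q)].

Definition is_coset_leader (n q s : nat) : bool :=
  all (fun x => (s <= x)%N) (cyc_coset n q s).

Definition MinRep (n q : nat) : seq nat :=
  [seq s <- iota 0 n | is_coset_leader n q s].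

Definition delta_in (q i n : nat) : nat :=
  nth 0%N (sort geq (MinRep n q)) i.-1.

Section Codes.
Variables (F : finFieldType) (n : nat).

Definition dotv (x y : 'rV[F]_n) : F := \sum_(i < n) x ord0 i * y ord0 i.

Definition dual_code (C : {set 'rV[F]_n}) : {set 'rV[F]_n} :=
  [set x | [forall c in C, dotv x c == 0]].

Definition is_LCD (C : {set 'rV[F]_n}) : Prop :=
  C :&: dual_code C = [set 0].

Definition code_dim (C : {set 'rV[F]_n}) : nat := \dim (span (enum C)).

Definition wt (x : 'rV[F]_n) : nat := #|[set i : 'I_n | x ord0 i != 0]|.

Definition min_dist_ge (C : {set 'rV[F]_n}) (D : nat) : Prop :=
  forall c, c \in C -> c != 0 -> (D <= wt c)%N.

Definition has_params (C : {set 'rV[F]_n}) (k D : nat) : Prop :=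
  code_dim C = k /\ min_dist_ge C D.

End Codes.

(* lcm of two polynomials over a field (defined up to a unit) *)
Definition lcmp (R : idomainType) (p r : {poly R}) : {poly R} := p * r %/ gcdp p r.

Section Cyclic.
Variables (F : finFieldType) (L : fieldExtType F) (n : nat) (beta : L).

Definition minpol (i : nat) : {poly L} := minPoly 1%VS (beta ^+ i).

Definition gen_poly (delta b : nat) : {poly L} :=
  \big[@lcmp L/1]_(b <= i < b + delta.-1) minpol i.

Definition word_poly (c : 'rV[F]_n) : {poly F} := \sum_(i < n) (c ord0 i)%:P * 'X^i.

Definition BCH (delta b : nat) : {set 'rV[F]_n} :=
  [set c | gen_poly delta b %| map_poly (in_alg L) (word_poly c)].

End Cyclic.

(* Main.v *)
Require Import Defs.
From HB Require Import structures.
From mathcomp Require Import all_boot all_order all_algebra all_field.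
From mathcomp Require Import zify ring lra.
Import Order.TTheory GRing.Theory Num.Theory.
Local Open Scope ring_scope.
Set Implicit Arguments. Unset Strict Implicit. Unset Printing Implicit Defensive.

(** Write [n = q ^ m + 1], [h = n / 2] and describe [s] by the signed residues
    [x_i = h - (s q^i mod n)]: then [x_(i+1) = q x_i - n c_i], [x_(i+m) = - x_i],
    and [s] is a coset leader iff [x_0 = max |x_i|].  So the large leaders are
    the antiperiodic orbits of [x -> q x mod n] that stay close to [0].

    If all [|x_i|] lie below [h - delta_3], the digits [c_i] are in [{-1, 0, 1}]
    and, up to sign, split into blocks B = (1, 0) and A = (1, 0, -1, 1), each
    followed by a block of opposite sign.  Without A the orbit is that of
    [delta_2].  An odd number [r] of B's between two A's forces [2 r > m - 8],
    against antiperiodicity; so all these numbers are even and every shift from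
    an A to an A is divisible by 4, against [m = 2 mod 4].

    The codes are read through their zeros: a word lies in the code iff it
    vanishes at [beta ^ j] for [j] in the defining range, hence on the union of
    the cosets of these [j].  The complement consists of the cosets of the few
    top leaders (and of [0]), which gives the dimension; [-1 = q ^ m mod n] gives
    closure under inversion, hence LCD and the doubled BCH bound. *)

(** * Signed residues and their digits *)

(* With [A = n / (q^2 + 1)] and [D = (q^(m - 4) + 1) / (q^2 + 1)], where [m >= 6],
   [q A] stands for [h - delta_2] and [U] for [h - delta_3]. *)
Section Bounds.
Variables (q A D n U : int).
Hypotheses (q3 : 3 <= q) (D1 : 1 <= D).
Hypotheses (AD : q ^+ 4 * D = A + q ^+ 2 - 1) (nA : n = (q ^+ 2 + 1) * A)
  (UE : U = q * A + (q - 1) ^+ 2 * D).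

Let AE : A = q ^+ 4 * D - q ^+ 2 + 1. Proof. by rewrite AD; ring. Qed.

Lemma U_gt0 : 0 < U.
Proof.
have A0 : 0 < A by rewrite AE; nia.
rewrite UE; apply: ltr_wpDr; first by rewrite mulr_ge0 ?sqr_ge0 //; lia.
by rewrite mulr_gt0 //; lia.
Qed.

Lemma qU_lt_n : q * U < n.
Proof.
rewrite -subr_gt0 UE nA.
(* Expanded around [D = 1], so that every summand is visibly nonnegative. *)
have -> : (q ^+ 2 + 1) * A - q * (q * A + (q - 1) ^+ 2 * D)
  = (q ^+ 3 * (q - 1) + (2 * q - 1) * q) * (D - 1) + q^+3 * (q - 2) + q * (q - 1) + q ^+ 2 * q + 1.
  by rewrite AE; ring.
have ? : 0 <= q ^+ 3 * (q - 1) by rewrite mulr_ge0 ?exprn_ge0 //; lia.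
have ? : 0 <= q ^+ 3 * (q - 2) by rewrite mulr_ge0 ?exprn_ge0 //; lia.
have ? : 0 <= (q ^+ 3 * (q - 1) + (2 * q - 1) * q) * (D - 1).
  by rewrite mulr_ge0 //; nia.
have ? : 0 <= q ^+ 2 * q by rewrite mulr_ge0 ?sqr_ge0 //; lia.
nia.
Qed.

Lemma modulus_gt0 : 0 < n.
Proof. by apply: lt_trans qU_lt_n; rewrite mulr_gt0 ?U_gt0 //; lia. Qed.

(* The right-hand side is [n] times the value of the digits 1, 0, -1, 1, -1, 1:
   this and the next lemmas say which digit prefixes push a residue beyond [U]. *)
Lemma prefix6_le : (q ^+ 6 + 1) * U <= n * (q ^+ 5 - q ^+ 3 + q ^+ 2 - q + 1).
Proof.
rewrite -subr_ge0 UE nA.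
have -> : (q ^+ 2 + 1) * A * (q ^+ 5 - q ^+ 3 + q ^+ 2 - q + 1) -
   (q ^+ 6 + 1) * (q * A + (q - 1) ^+ 2 * D) = (D - 1) * ((q - 1) ^+ 2 * (q ^+ 4 - 1)).
  by rewrite AE; ring.
rewrite !mulr_ge0 ?sqr_ge0 ?subr_ge0 ?exprn_ege1 //; lia.
Qed.

Lemma prefix5_lt : (q ^+ 5 + 1) * U < n * (q ^+ 4 - q ^+ 2 + q).
Proof.
have q0 : 0 < q by lia.
rewrite -(ltr_pM2l q0).
have -> : q * ((q ^+ 5 + 1) * U) = (q ^+ 6 + 1) * U + (q - 1) * U by ring.
have -> : q * (n * (q ^+ 4 - q ^+ 2 + q)) =
  n * (q ^+ 5 - q ^+ 3 + q ^+ 2 - q + 1) + (q - 1) * n by ring.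
apply: ler_ltD prefix6_le _; rewrite ltr_pM2l; last lia.
by have := qU_lt_n; have := U_gt0; nia.
Qed.

Lemma prefix3_lt : (q ^+ 3 + 1) * U < n * q ^+ 2.
Proof.
have q0 : 0 < q by lia.
rewrite -(ltr_pM2l q0).
have -> : q * ((q ^+ 3 + 1) * U) = (q ^+ 3 + 1) * (q * U) by ring.
have h := qU_lt_n; have U0 := U_gt0.
have n0 : 0 < n by nia.
have -> : q * (n * q ^+ 2) = q ^+ 3 * n by ring.
have h5 := prefix5_lt.
have q2 : 0 < q ^+ 2 by rewrite exprn_gt0.
rewrite -(ltr_pM2l q2).
have -> : q ^+ 2 * ((q ^+ 3 + 1) * (q * U)) =
  q * ((q ^+ 5 + 1) * U) + (q ^+ 2 - 1) * (q * U) by ring.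
apply: (@lt_le_trans _ _ (q * (n * (q ^+ 4 - q ^+ 2 + q)) + (q ^+ 2 - 1) * n)).
  apply: ltrD; first by rewrite ltr_pM2l.
  by rewrite ltr_pM2l // subr_gt0 exprn_egt1 //; lia.
rewrite -subr_ge0.
have -> : q ^+ 2 * (q ^+ 3 * n) - (q * (n * (q ^+ 4 - q ^+ 2 + q)) + (q ^+ 2 - 1) * n)
  = n * (q ^+ 2 * (q - 2) + 1) by ring.
by rewrite mulr_ge0 // ?addr_ge0 ?mulr_ge0 ?sqr_ge0 //; lia.
Qed.

Lemma prefix2_lt : (q ^+ 2 + 1) * U < n * (q + 1).
Proof.
have h := qU_lt_n; have U0 := U_gt0.
apply: (@le_lt_trans _ _ ((q + 1) * (q * U))); last by rewrite mulrC ltr_pM2r //; lia.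
by rewrite mulrA ler_pM2r //; lia.
Qed.

Lemma prefix1_lt : (q + 1) * U < n * 2.
Proof. by have h := qU_lt_n; have U0 := U_gt0; nia. Qed.

End Bounds.

(** * Digit blocks of the orbits below [U] *)

Section Blocks.
Variables (q A D n U : int).
Hypotheses (q3 : 3 <= q) (D1 : 1 <= D).
Hypotheses (AD : q ^+ 4 * D = A + q ^+ 2 - 1) (nA : n = (q ^+ 2 + 1) * A)
  (UE : U = q * A + (q - 1) ^+ 2 * D).

(** A signed base-[q] expansion: [x i / n] is the sum of the [c (i + j) / q ^ (j + 1)]. *)
Definition orbit_seq (x c : nat -> int) : Prop :=
  (forall i, x i.+1 = q * x i - n * c i) /\ (forall i, `|x i| < U).

Lemma orbit_seqN x c : orbit_seq x c -> orbit_seq (fun i => - x i) (fun i => - c i).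
Proof.
by case=> xc xU; split=> i; rewrite ?normrN // xc; ring.
Qed.

Let U0 : 0 < U. Proof. exact: (U_gt0 q3 D1 AD nA UE). Qed.
Let n0 : 0 < n. Proof. exact: (modulus_gt0 q3 D1 AD nA UE). Qed.

(** How a prefix bound excludes a prefix: [q ^ k * x i] is [n] times the value of the next [k]
    digits plus [x (i + k)], and the latter exceeds [- U]. *)
Let big x c k i : orbit_seq x c -> (q ^+ k + 1) * U <= q ^+ k * x i + U -> False.
Proof.
case=> _ /(_ i) h.
have : q ^+ k * x i < q ^+ k * U by rewrite ltr_pM2l ?exprn_gt0 //; lia.
lia.
Qed.

Lemma digit_le1 x c i : orbit_seq x c -> -1 <= c i <= 1.
Proof.
case=> xc xU; suff : `|c i| < 2 by lia.
rewrite -(ltr_pM2l n0) -{1}(gtr0_norm n0) -normrM.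
have -> : n * c i = q * x i - x i.+1 by rewrite xc; ring.
apply: le_lt_trans (ler_normB _ _) (lt_trans _ (prefix1_lt q3 D1 AD nA UE)).
rewrite normrM gtr0_norm ?mulrDl ?mul1r; last lia.
by rewrite ltrD // ltr_pM2l //; lia.
Qed.

Lemma digit_next x c i : orbit_seq x c -> c i = 1 -> c i.+1 <> 1.
Proof.
move=> xcU c0 c1; apply: (@big x c 2 i) => //; case: xcU => xc xU.
have := prefix2_lt q3 D1 AD nA UE; have := xU i.+2; rewrite ltr_norml xc xc c0 c1.
lra.
Qed.

Lemma digit_nextN x c i : orbit_seq x c -> c i = -1 -> c i.+1 <> -1.
Proof.
move=> /orbit_seqN xcU c0 c1.
by apply: (digit_next (i := i) xcU); rewrite ?c0 ?c1 opprK.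
Qed.

(** After 1, 0 the residue is so close to [U] that later digits must pull it down: [prefix3_lt]
    forces -1; if 1 follows, [prefix5_lt] forces -1 again and [prefix6_le] bars another 1. *)
Lemma block x c i : orbit_seq x c -> c i = 1 -> c i.+1 = 0 ->
  c i.+2 = -1 /\ (c i.+3 = 0 \/ [/\ c i.+3 = 1, c i.+4 = -1 & c i.+4.+1 = 0]).
Proof.
move=> xcU c0 c1; have d k := digit_le1 k xcU; have [xc xU] := xcU.
have dn k : 0 <= c k -> 0 <= n * c k by move=> ?; rewrite mulr_ge0 // ltW.
have c2 : c i.+2 = -1.
  suff : ~ (0 <= c i.+2) by have := d i.+2; lia.
  move=> /dn c2; apply: (@big x c 3 i) => //.
  have := prefix3_lt q3 D1 AD nA UE; have := xU i.+3; rewrite ltr_norml 3!xc c0 c1.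
  lra.
split=> //; have c3N := digit_nextN xcU c2.
have [|c3] : c i.+3 = 0 \/ c i.+3 = 1 by have := d i.+3; lia.
  by left.
right; have c4 : c i.+4 = -1.
  suff : ~ (0 <= c i.+4) by have := d i.+4; lia.
  move=> /dn c4; apply: (@big x c 5 i) => //.
  have := prefix5_lt q3 D1 AD nA UE; have := xU i.+4.+1; rewrite ltr_norml 5!xc c0 c1 c2 c3.
  lra.
split=> //; have c5N := digit_nextN xcU c4.
suff : ~ (c i.+4.+1 = 1) by have := d i.+4.+1; lia.
move=> c5; apply: (@big x c 6 i) => //.
have := prefix6_le q3 D1 AD nA UE; have := xU i.+4.+2; rewrite ltr_norml 6!xc c0 c1 c2 c3 c4 c5.
lra.
Qed.

End Blocks.

(** * Runs of short blocks between long ones, for [m = 4 * t + 6] *)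

Section Runs.
Variables (q A D n U : int) (t : nat).
Hypotheses (q3 : 3 <= q) (D1 : 1 <= D).
Hypotheses (AD : q ^+ 4 * D = A + q ^+ 2 - 1) (nA : n = (q ^+ 2 + 1) * A)
  (UE : U = q * A + (q - 1) ^+ 2 * D)
  (A_sub_D : A - D = q ^+ (4 * t + 2) * (q ^+ 2 - 1)).
Variables x c : nat -> int.
Hypotheses (xcU : orbit_seq q n U x c).
Hypothesis anti : forall i, x (i + (4 * t + 6))%N = - x i.

Let xc : forall i, x i.+1 = q * x i - n * c i. Proof. by case: xcU. Qed.
Let xU : forall i, `|x i| < U. Proof. by case: xcU. Qed.
Let n0 : 0 < n. Proof. exact: (modulus_gt0 q3 D1 AD nA UE). Qed.

Lemma digit_anti i : c (i + (4 * t + 6))%N = - c i.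
Proof.
have := xc (i + (4 * t + 6))%N; rewrite -addSn !anti xc.
move=> h; apply: (mulfI (lt0r_neq0 n0)); lra.
Qed.

(** Only the parity of [k] matters: it is the sign of the block, which flips from each block to the
    next. *)
Definition block_start k i := (-1) ^+ k * c i = 1 /\ c i.+1 = 0.
(* Vanishes on the orbit of [delta_2]. *)
Definition excess k i := (-1) ^+ k * x i - q * A.

Lemma orbit_seq_sign k : orbit_seq q n U (fun i => (-1) ^+ k * x i) (fun i => (-1) ^+ k * c i).
Proof.
split=> i; first by rewrite xc; ring.
by rewrite normrMsign.
Qed.

(* The first case is the block B of the header, the second one the block A. *)
Lemma block_next k i : block_start k i ->
  [/\ c i.+3 = 0, block_start k.+1 i.+2 & excess k.+1 i.+2 = - q ^+ 2 * excess k i]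
  \/ [/\ c i.+3 <> 0, block_start k.+1 i.+4
      & excess k.+1 i.+4 = (q - 1) ^+ 2 * A - q ^+ 4 * excess k i].
Proof.
case=> ci c1.
have c1' : (-1) ^+ k * c i.+1 = 0 by rewrite c1 mulr0.
have [c2] := block q3 D1 AD nA UE (orbit_seq_sign k) ci c1'.
have sgE (y : int) : (-1) ^+ k * y = 0 -> y = 0.
  by move/eqP; rewrite mulf_eq0 signr_eq0 => /eqP.
have ss : (-1) ^+ k * (-1) ^+ k = 1 :> int by rewrite -expr2 sqrr_sign.
have sgK y : y = (-1) ^+ k * ((-1) ^+ k * y) :> int by rewrite mulrA ss mul1r.
have c0E : c i = (-1) ^+ k by rewrite [LHS]sgK ci mulr1.
have c2E : c i.+2 = - (-1) ^+ k by rewrite [LHS]sgK c2 mulrN1.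
have xE := sgK (x i).
rewrite /excess; set y := (-1) ^+ k * x i in xE *.
pose a := (q ^+ 2 + 1) * A.
case=> [/sgE c3 | [c3 c4 /sgE c5]].
  left; split=> //.
    by split=> //; rewrite exprS mulN1r mulNr c2.
  rewrite 2!xc c1 exprS c0E xE nA -/a.
  set s := (-1) ^+ k in ss *.
  transitivity (- (s * s) * (q * (q * y - a)) - q * A); first by ring.
  by rewrite ss /a; ring.
have c3E : c i.+3 = (-1) ^+ k by rewrite [LHS]sgK c3 mulr1.
right; split.
- by move=> e; move: c3; rewrite e mulr0.
- by split=> //; rewrite exprS mulN1r mulNr c4.
rewrite 4!xc c1 exprS c0E c2E c3E xE nA -/a.
set s := (-1) ^+ k in ss *.
transitivity (- (s * s) * (q ^+ 4 * y - a * (q ^+ 3 - q + 1)) - q * A).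
  by ring.
by rewrite ss /a; ring.
Qed.

(** A run of [r] blocks B. The fourth digit tells the blocks apart: it is the 0 of the following
    block after B, and the last digit of A otherwise. *)
Definition short_run k i r :=
  [/\ forall j, (j < r)%N -> c (i + j.*2).+3 = 0, block_start (k + r) (i + r.*2)
    & excess (k + r) (i + r.*2) = (- q ^+ 2) ^+ r * excess k i].

Lemma short_run_split k i N : block_start k i ->
  short_run k i N \/
  exists r, [/\ (r < N)%N, short_run k i r & c (i + r.*2).+3 <> 0].
Proof.
move=> bi; elim: N => [|N [[h1 h2 h3]|[r [rN h1 h2]]]].
- by left; split=> //; rewrite ?addn0 // expr0 mul1r.
- case: (block_next h2) => -[h4 h5 h6]; last by right; exists N.
  left; split.
  + by move=> j; rewrite ltnS leq_eqVlt => /orP[/eqP-> //|]; apply: h1.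
  + by rewrite addnS doubleS !addnS.
  + by rewrite addnS doubleS !addnS h6 h3 [in RHS]exprS mulrA.
- by right; exists r; split=> //; apply: ltnW.
Qed.

Lemma excess_lt k i : excess k i < (q - 1) ^+ 2 * D.
Proof.
rewrite /excess ltrBlDl -UE; apply: le_lt_trans (xU i).
by rewrite -(normrMsign k) ler_norm.
Qed.

Hypothesis xN0 : forall i, x i <> 0.
Hypothesis xNqA : forall i, `|x i| <> q * A.

Lemma digit_nonzero : exists i, c i <> 0.
Proof.
case: (boolP [exists i : 'I_(4 * t + 6), c i != 0]) => [/existsP[i /eqP ci]|].
  by exists i.
rewrite negb_exists => /forallP c0; case: (@xN0 0%N).
have xq i : (i <= 4 * t + 6)%N -> x i = q ^+ i * x 0%N.
  elim: i => [|i IH] im; first by rewrite expr0 mul1r.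
  have := c0 (Ordinal im); rewrite negbK /= => /eqP ci.
  by rewrite xc ci mulr0 subr0 IH ?exprS ?mulrA // ltnW.
have := anti 0; rewrite add0n xq // => h.
have q0 : 0 < q ^+ (4 * t + 6) by rewrite exprn_gt0 //; lia.
have : (q ^+ (4 * t + 6) + 1) * x 0%N = 0 by rewrite mulrDl h; ring.
move/eqP; rewrite mulf_eq0 => /orP[/eqP|/eqP //]; lia.
Qed.

(** If no nonzero digit were followed by 0, the digits would alternate in sign from [i0] on; as [m]
    is even, the digit at [i0 + m] would equal that at [i0], against antiperiodicity. *)
Lemma block_start_exists : exists k i, block_start k i.
Proof.
have d k := digit_le1 q3 D1 AD nA UE k xcU.
have [i0 ci0] := digit_nonzero.
have sg i : c i <> 0 -> exists k, (-1) ^+ k * c i = 1.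
  move=> ci; have [->|->] : c i = 1 \/ c i = -1 by have := d i; lia.
    by exists 0%N.
  by exists 1%N.
case: (boolP [exists j : 'I_(4 * t + 6), (c (i0 + j)%N != 0) && (c (i0 + j).+1 == 0)]).
  by case/existsP=> j /andP[/eqP/sg[k h1] /eqP h2]; exists k, (i0 + j)%N.
rewrite negb_exists => /forallP nb.
have alt j : (j <= 4 * t + 6)%N -> c (i0 + j)%N = (-1) ^+ j * c i0.
  elim: j => [|j IH] jm; first by rewrite addn0 expr0 mul1r.
  have := nb (Ordinal jm); rewrite /= negb_and negbK IH ?(ltnW jm) //.
  rewrite mulf_eq0 signr_eq0 (negPf (introN eqP ci0)) /= => /eqP cN.
  have := digit_next q3 D1 AD nA UE (i := (i0 + j)%N) xcU.
  have := digit_nextN q3 D1 AD nA UE (i := (i0 + j)%N) xcU.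
  rewrite IH ?(ltnW jm) // addnS exprS mulN1r mulNr.
  have := d (i0 + j).+1; have := d (i0 + j)%N; rewrite IH ?(ltnW jm) //.
  set y := _ * _; have : y <> 0.
    by move/eqP; rewrite mulf_eq0 signr_eq0 => /eqP.
  lia.
have := alt _ (leqnn _); rewrite digit_anti.
have -> : (4 * t + 6 = (2 * t + 3).*2)%N by lia.
by rewrite -mul2n exprM sqrrN !expr1n mul1r; lia.
Qed.

(** With B's only, [m / 2] blocks multiply the excess by [- q ^ m]. This number of blocks is odd, so
    their sign cancels that of antiperiodicity and the excess also returns to itself. Hence it is 0,
    which [xNqA] rules out. *)
Lemma long_block_exists : exists k i, block_start k i /\ c i.+3 <> 0.
Proof.
have [k [i bi]] := block_start_exists.
case: (short_run_split (2 * t + 3) bi) => [[_ _ eE]|[r [_ [_ h _] c3]]]; last first.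
  by exists (k + r)%N, (i + r.*2)%N.
exfalso; move: eE.
have -> : ((2 * t + 3).*2 = 4 * t + 6)%N by lia.
rewrite /excess anti exprD.
have -> : (-1 : int) ^+ (2 * t + 3) = -1.
  by rewrite -signr_odd; have -> : odd (2 * t + 3) by lia.
have -> : (- q ^+ 2) ^+ (2 * t + 3) = - q ^+ (4 * t + 6).
  rewrite exprNn -signr_odd; have -> : odd (2 * t + 3) by lia.
  by rewrite -exprM expr1 mulN1r; congr (- q ^+ _); lia.
set y := _ - _ => h.
have q0 : 0 < q ^+ (4 * t + 6) by rewrite exprn_gt0 //; lia.
have : (q ^+ (4 * t + 6) + 1) * (excess k i) = 0.
  move: h; rewrite /y /excess; lra.
move/eqP; rewrite mulf_eq0 => /orP[/eqP|/eqP e0]; first lia.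
case: (@xNqA i); rewrite -(normrMsign k).
have -> : (-1) ^+ k * x i = q * A by move: e0; rewrite /excess; lra.
rewrite ger0_norm // mulr_ge0 //; first lia.
by move: n0; rewrite nA pmulr_rgt0 ?addr_gt0 ?exprn_gt0 //; lia.
Qed.

Lemma long_block_next k i : block_start k i -> c i.+3 <> 0 ->
  exists r, [/\ ~~ odd r, (r < 2 * t + 1)%N, short_run k.+1 i.+4 r & c (i.+4 + r.*2).+3 <> 0].
Proof.
move=> bi c3; case: (block_next bi) => -[c3' b4 e4]; first by [].
case: (short_run_split (2 * t + 1) b4) => [[_ bN _]|[r [rN br c7]]].
  (* A block A and [2 t + 1] blocks B fill exactly [m] digits and change the sign an even number of
     times, against antiperiodicity. *)
  move: bN; have -> : (i.+4 + (2 * t + 1).*2 = i + (4 * t + 6))%N by lia.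
  case; rewrite digit_anti exprD exprS.
  have -> : (-1 : int) ^+ (2 * t + 1) = -1.
    by rewrite -signr_odd; have -> : odd (2 * t + 1) by lia.
  by case: bi => h _; rewrite -[X in _ * X]opprK; move: h; lra.
exists r; split=> //; apply/negP => r_odd.
have [_ b5 e5] := br.
case: (block_next b5) => -[c7' _ e8]; first by [].
(* For odd [r], carry the excess through A, the B's and the next A. The bound [excess_lt] at both
   ends would give [q ^ (4 t + 2) < q ^ (2 r + 4)]. *)
have := excess_lt (k.+1 + r).+1 (i.+4 + r.*2).+4.
rewrite e8 e5 e4 exprNn -signr_odd r_odd expr1 -exprM.
have := excess_lt k i.
set e := excess k i; set E := _ * D; set Q := q ^+ (2 * r) => eE h.
have Q0 : 0 < Q by rewrite exprn_gt0 //; lia.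
have p0 : 0 < (q - 1) ^+ 2 * (q ^+ 2 - 1).
  by rewrite mulr_gt0 ?exprn_gt0 ?subr_gt0 ?exprn_egt1 //; lia.
(* Being odd and below [2 t + 1], [r] is at most [2 t - 1]. *)
have Qr : Q * q ^+ 4 <= q ^+ (4 * t + 2).
  by rewrite /Q -exprD ler_weXn2l //; lia.
have h2 : (q - 1) ^+ 2 * A - q ^+ 4 * e > - ((q - 1) ^+ 2 * (q ^+ 2 - 1)).
  apply: (@le_lt_trans _ _ ((q - 1) ^+ 2 * A - q ^+ 4 * E)).
    rewrite /E; have -> : q ^+ 4 * ((q - 1) ^+ 2 * D) = (q - 1) ^+ 2 * (q ^+ 4 * D) by ring.
    by rewrite AD; lra.
  by rewrite ltrD2l ltrN2 ltr_pM2l // exprn_gt0 //; lia.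
have h3 : q ^+ 4 * Q * ((q - 1) ^+ 2 * A - q ^+ 4 * e) >
    q ^+ 4 * Q * - ((q - 1) ^+ 2 * (q ^+ 2 - 1)).
  by rewrite ltr_pM2l // mulr_gt0 // exprn_gt0 //; lia.
have h4 : Q * q ^+ 4 * ((q - 1) ^+ 2 * (q ^+ 2 - 1)) <= (q - 1) ^+ 2 * (A - D).
  rewrite A_sub_D; set W := q ^+ (4 * t + 2) in Qr *.
  rewrite [leRHS](_ : _ = W * ((q - 1) ^+ 2 * (q ^+ 2 - 1))); last by ring.
  by rewrite ler_pM2r.
move: h; rewrite /E; lra.
Qed.

(** Descent on the distance from an A at [p] to the A that antiperiodicity puts at [i + m]. The next
    A is [4 + 2 r] further with [r] even, so the distance stays 2 modulo 4: it cannot be jumped to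
    exactly, nor can a run of B's cover [i + m]. *)
Lemma long_block_absurd d k i p : block_start k i -> c i.+3 <> 0 ->
  forall k', block_start k' p -> c p.+3 <> 0 ->
  (p + (4 * d + 2) = i + (4 * t + 6))%N -> False.
Proof.
move=> bi ci3; elim/ltn_ind: d p => d IH p k' bp cp pd.
have [b1 b3] : c (p + (4 * d + 2)).+1 = 0 /\ c (p + (4 * d + 2)).+3 <> 0.
  rewrite pd -!addSn !digit_anti; case: bi => _ ->; split; lia.
(* For [d = 0] a block would start at [p + 2], so that [c p.+3] is 0 and the block at [p] is not an
   A. *)
have d0 : (0 < d)%N.
  rewrite lt0n; apply/eqP => d0; move: b1; rewrite d0 muln0 add0n addn2.
  exact: cp.
have [r [r_even rt [r1 r2 r3] r4]] := long_block_next bp cp.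
case: (ltngtP r (2 * d - 1)) => [rd|rd|rd].
- have [dr pr] : (d - 1 - r./2 < d)%N /\
      (p.+4 + r.*2 + (4 * (d - 1 - r./2) + 2) = i + (4 * t + 6))%N.
    by clear -r_even rd pd d0; lia.
  exact: (IH _ dr _ _ r2 r4).
- apply: b3; have := r1 (2 * d - 1)%N rd; congr (c _.+3 = 0); lia.
- lia.
Qed.

Lemma no_small_orbit : False.
Proof.
have [k [i [bi ci]]] := long_block_exists.
(* The descent starts at [p = i], since [4 (t + 1) + 2] is [m] itself. *)
apply: (@long_block_absurd (t + 1) k i i bi ci k bi ci); lia.
Qed.

End Runs.

(** * The orbit of [U] under multiplication by [q] *)

Section Witness.
Variables (q A D n U : int) (t : nat).
Hypotheses (q3 : 3 <= q) (D1 : 1 <= D).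
Hypotheses (AD : q ^+ 4 * D = A + q ^+ 2 - 1) (nA : n = (q ^+ 2 + 1) * A)
  (UE : U = q * A + (q - 1) ^+ 2 * D)
  (A_sub_D : A - D = q ^+ (4 * t + 2) * (q ^+ 2 - 1))
  (Dq : (q ^+ 2 + 1) * D = q ^+ (4 * t + 2) + 1).

(* From step 4 on, the orbit of [U] is [V i] plus [- q A], [A], [q A] or [- A],
   according to [i mod 4]. *)
Let V i : int := q ^+ i * (q - 1) ^+ 2 * (q ^+ 2 - 1).

Let q0 : 0 < q. Proof. lia. Qed.
Let q1 : 0 < q - 1. Proof. lia. Qed.
Let qq1 : 0 < q ^+ 2 - 1. Proof. by rewrite subr_gt0 exprn_egt1 //; lia. Qed.
Let A0 : 0 < A.
Proof. by have := modulus_gt0 q3 D1 AD nA UE; rewrite nA pmulr_rgt0 ?addr_gt0 ?exprn_gt0. Qed.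
Let W0 : 0 < (q - 1) ^+ 2 * D. Proof. by rewrite mulr_gt0 ?exprn_gt0 //; lia. Qed.

Let V0 i : 0 < V i. Proof. by rewrite !mulr_gt0 ?exprn_gt0. Qed.

Let V_le i : (i <= 4 * t + 1)%N -> V i <= (q - 1) * A.
Proof.
move=> it; rewrite /V expr2 -!mulrA mulrCA ler_pM2l //.
apply: le_trans (_ : q ^+ (4 * t + 2) * (q ^+ 2 - 1) <= _); last by rewrite -A_sub_D; lia.
rewrite mulrA ler_pM2r // (_ : 4 * t + 2 = (4 * t + 1).+1)%N ?exprSr; last lia.
by rewrite ler_pM ?exprn_ge0 ?ler_weXn2l //; lia.
Qed.

Let V_lt i : (i.+4 <= 4 * t + 2)%N -> V i < (q - 1) ^+ 2 * D.
Proof.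
move=> it; rewrite /V [q ^+ i * _]mulrC -mulrA ltr_pM2l ?exprn_gt0 //.
have q21 : 0 < q ^+ 2 + 1 by rewrite addr_gt0 ?exprn_gt0.
rewrite -(ltr_pM2l q21) Dq.
rewrite [ltLHS](_ : _ = q ^+ i.+4 - q ^+ i); last by rewrite -addn4 exprD; ring.
have : q ^+ i.+4 <= q ^+ (4 * t + 2) by rewrite ler_weXn2l //; lia.
have : 0 < q ^+ i by rewrite exprn_gt0.
lia.
Qed.

Let W_lt : (q ^+ 3 - 1) * ((q - 1) ^+ 2 * D) < (q - 1) * A.
Proof.
rewrite expr2 -!mulrA mulrCA ltr_pM2l //.
have -> : A = q ^+ 4 * D - q ^+ 2 + 1 by rewrite AD; ring.
rewrite -subr_gt0 [ltRHS](_ : _ = (q ^+ 3 + (q - 1)) * (D - 1) + q ^+ 2 * (q - 1) + q);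
  last by ring.
have Dm : 0 <= D - 1 by lia.
have h1 : 0 <= (q ^+ 3 + (q - 1)) * (D - 1).
  by rewrite mulr_ge0 // addr_ge0 ?exprn_ge0 // ltW.
have h2 : 0 <= q ^+ 2 * (q - 1) by rewrite mulr_ge0 ?exprn_ge0 // ltW.
by rewrite ltr_wpDl // addr_ge0.
Qed.

(** Makes the bound of [no_small_orbit] sharp: [U] is the strict maximum of its own orbit over a
    half period, which gives both a leader and a coset of full size. *)
Lemma witness_orbit j : (0 < j < 4 * t + 6)%N ->
  exists z k, z = U * q ^+ j + n * k /\ `|z| < U.
Proof.
have W1 : (q - 1) ^+ 2 * D <= q * ((q - 1) ^+ 2 * D) by rewrite ler_peMl //; lia.
have W2 : q * ((q - 1) ^+ 2 * D) <= q ^+ 2 * ((q - 1) ^+ 2 * D).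
  by rewrite [q ^+ 2]expr2 -mulrA ler_pM2l.
have W3 : q ^+ 2 * ((q - 1) ^+ 2 * D) <= q ^+ 3 * ((q - 1) ^+ 2 * D).
  by rewrite [q ^+ 3]exprSr -mulrA ler_pM2l // exprn_gt0.
have Wl := W_lt; rewrite mulrBl mul1r in Wl.
have qA : A <= q * A by rewrite ler_peMl ?ltW //; lia.
case: j => [//|[|[|[|j]]]] jt.
- exists (q * ((q - 1) ^+ 2 * D) - A), (-1); split; first by rewrite UE nA; ring.
  by rewrite UE; lia.
- exists (q ^+ 2 * ((q - 1) ^+ 2 * D) - q * A), (- q); split; first by rewrite UE nA; ring.
  by rewrite UE; lia.
- exists (q ^+ 3 * ((q - 1) ^+ 2 * D) + A), (1 - q ^+ 2); split; first by rewrite UE nA; ring.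
  by rewrite UE; lia.
have z4 a : exists k, V (4 * a) - q * A = U * q ^+ (4 * a + 4) + n * k.
  elim: a => [|a [k IH]].
    exists (- (q ^+ 3 - q + 1)); rewrite UE mulrDl [_ * D * _]mulrC [_ * (_ * D)]mulrCA AD nA /V.
    by rewrite muln0; ring.
  exists (k * q ^+ 4 + q * (q ^+ 2 - 1)).
  rewrite (_ : 4 * a.+1 = 4 * a + 4)%N ?(exprD q (4 * a + 4) 4) ?mulrA; last lia.
  have -> : U * q ^+ (4 * a + 4) = V (4 * a) - q * A - n * k by rewrite IH; ring.
  by rewrite /V exprD nA; ring.
have z5 a : exists k, V (4 * a + 1) + A = U * q ^+ (4 * a + 5) + n * k.
  have [k e] := z4 a; exists (k * q + 1).
  have -> : U * q ^+ (4 * a + 5) = q * (V (4 * a) - q * A - n * k).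
    by rewrite addnS exprS e; ring.
  by rewrite /V exprD nA; ring.
have z6 a : exists k, V (4 * a + 2) + q * A = U * q ^+ (4 * a + 6) + n * k.
  have [k e] := z5 a; exists (k * q).
  have -> : U * q ^+ (4 * a + 6) = q * (V (4 * a + 1) + A - n * k).
    by rewrite addnS exprS e; ring.
  by rewrite /V !exprD nA; ring.
have z7 a : exists k, V (4 * a + 3) - A = U * q ^+ (4 * a + 7) + n * k.
  have [k e] := z6 a; exists (k * q - 1).
  have -> : U * q ^+ (4 * a + 7) = q * (V (4 * a + 2) + q * A - n * k).
    by rewrite addnS exprS e; ring.
  by rewrite /V !exprD nA; ring.
have Vj := V0 j; have Vle : V j <= (q - 1) * A by apply: V_le; clear -jt; lia.
rewrite mulrBl mul1r in Vle.
have jE : j = (4 * (j %/ 4) + j %% 4)%N by rewrite mulnC -divn_eq.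
have := ltn_pmod j (isT : 0 < 4)%N.
case r : (j %% 4)%N jE => [|[|[|[|//]]]] jE _.
- have [k e] := z4 (j %/ 4)%N; exists (V j - q * A), k; split; last by rewrite UE; lia.
  by rewrite jE addn0 e addn4.
- have [k e] := z5 (j %/ 4)%N; exists (V j + A), k; split; last by rewrite UE; lia.
  by rewrite jE e -!addnS.
(* The tight residue class: with [q A] added, [V j] must stay below [U - q A]. It does, because
   [j = 2] modulo 4 and [j <= 4 t + 1] give [j <= 4 t - 2]. *)
- have Vlt : V j < (q - 1) ^+ 2 * D by apply: V_lt; clear -jt r; lia.
  have [k e] := z6 (j %/ 4)%N; exists (V j + q * A), k; split; last by rewrite UE; lia.
  by rewrite jE e -!addnS.
- have [k e] := z7 (j %/ 4)%N; exists (V j - A), k; split; last by rewrite UE; lia.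
  by rewrite jE e -!addnS.
Qed.
End Witness.

(* [(q ^ (4 t + 2) + 1) / (q ^ 2 + 1)] *)
Fixpoint alt_geom (q : int) (t : nat) : int :=
  if t is t'.+1 then q ^+ 4 * alt_geom q t' - q ^+ 2 + 1 else 1.

Lemma alt_geomE q t : (q ^+ 2 + 1) * alt_geom q t = q ^+ (4 * t + 2) + 1.
Proof.
elim: t => [|t IH]; first by rewrite mulr1.
rewrite (_ : 4 * t.+1 + 2 = 4 + (4 * t + 2))%N; last lia.
rewrite exprD; have -> : q ^+ (4 * t + 2) = (q ^+ 2 + 1) * alt_geom q t - 1 by rewrite IH addrK.
by rewrite /=; ring.
Qed.

Lemma alt_geom_ge1 q t : 3 <= q -> 1 <= alt_geom q t.
Proof.
move=> q3; have q21 : 0 < q ^+ 2 + 1 by rewrite addr_gt0 ?exprn_gt0 //; lia.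
rewrite -(ler_pM2l q21) alt_geomE mulr1 lerD2r ler_weXn2l //; lia.
Qed.

(* For [m = 2] the extremal digits are 1, 1 instead of 1, 0, -1, 1, ... *)
Definition gap3Z (q t : nat) : int :=
  if t is t'.+1 then q%:Z * alt_geom q t + (q%:Z - 1) ^+ 2 * alt_geom q t'
  else q%:Z + 1.

(** * Deviations of the second and third leaders from [n / 2] *)

Section Gap.
Variables (q t : nat).
Hypothesis q3 : (3 <= q)%N.
Notation n := (q%:Z ^+ (4 * t + 2) + 1).
Notation A := (alt_geom q t).
Notation U := (gap3Z q t).

Let q3' : 3 <= q%:Z. Proof. by lia. Qed.

Lemma gap2_lt_gap3Z : q%:Z * A < U.
Proof.
case: t => [|t'] /=; first by lia.
rewrite ltrDl mulr_gt0 ?exprn_gt0 //; first lia.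
exact: lt_le_trans (alt_geom_ge1 _ q3').
Qed.

Let D1 t' := alt_geom_ge1 t' q3'.
Let AD t' : q%:Z ^+ 4 * alt_geom q t' = alt_geom q t'.+1 + q%:Z ^+ 2 - 1.
Proof. by rewrite /=; ring. Qed.

Let A_sub_D t' : alt_geom q t'.+1 - alt_geom q t' = q%:Z ^+ (4 * t' + 2) * (q%:Z ^+ 2 - 1).
Proof.
have q21 : q%:Z ^+ 2 + 1 != 0 by rewrite lt0r_neq0 // addr_gt0 ?exprn_gt0 //; lia.
apply: (mulfI q21); rewrite mulrBr !alt_geomE.
rewrite (_ : 4 * t'.+1 + 2 = 4 + (4 * t' + 2))%N; last lia.
by rewrite exprD; ring.
Qed.

Lemma gap3Z_lt_half : 2 * U < n.
Proof.
case: t => [|t'] /=; first by rewrite expr2; nia.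
rewrite -alt_geomE.
have := qU_lt_n q3' (D1 t') (AD t') erefl erefl.
have := U_gt0 q3' (D1 t') (AD t') erefl erefl.
rewrite -/(alt_geom q t'.+1); set u := _ + _; set v := _ * alt_geom _ _ => u0.
have : 3 * u <= q%:Z * u by rewrite ler_pM2r.
lia.
Qed.

Lemma small_orbit (x : nat -> int) :
  (forall i, (n %| x i.+1 - q%:Z * x i)%Z) ->
  (forall i, x (i + (4 * t + 2))%N = - x i) ->
  (forall i, `|x i| < U) ->
  exists i, x i = 0 \/ `|x i| = q%:Z * A.
Proof.
move=> xd anti xU.
pose c i := - ((x i.+1 - q%:Z * x i) %/ n)%Z.
have xc i : x i.+1 = q%:Z * x i - n * c i.
  by rewrite /c mulrN opprK [n * _]mulrC divzK // addrC subrK.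
case: t xc anti xU {xd} => [|t'] xc anti xU.
  (* Case [m = 2], where all [|x i| <= q]: digit 0 gives [x 1 = q * x 0], and any other digit forces
     [|x 0| = q]. *)
  have : x 0%N = 0 \/ `|x 0%N| = q%:Z \/ `|x 1%N| = q%:Z.
    have := xc 0%N; have := xU 0%N; have := xU 1%N.
    rewrite /= expr2; move: (x 0%N) (x 1%N) (c 0%N) => x0 x1 c0 h1 h0 e.
    have [ce|[ce|ce]] : c0 = 0 \/ 1 <= c0 \/ c0 <= -1 by lia.
    - rewrite ce in e; have [|[x0p|x0p]] : x0 = 0 \/ 1 <= x0 \/ x0 <= -1 by lia.
      + by left.
      + by right; right; nia.
      + by right; right; nia.
    - by right; left; nia.
    - by right; left; nia.
  rewrite mulr1.
  by case=> [?|[?|?]]; [exists 0%N; left|exists 0%N; right|exists 1%N; right].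
(* [P] is invariant under the shift by [m], so a finite search decides whether it ever holds. *)
pose P i := (x i == 0) || (`|x i| == q%:Z * alt_geom q t'.+1).
have Pm i : P (i + (4 * t' + 6))%N = P i.
  have e : (4 * t'.+1 + 2 = 4 * t' + 6)%N by lia.
  by rewrite /P -e anti oppr_eq0 normrN.
have [/existsP[i /orP[/eqP|/eqP] Pi]|] := boolP [exists i : 'I_(4 * t' + 6), P i].
- by exists i; left.
- by exists i; right.
rewrite negb_exists => /forallP NP; exfalso.
have {}NP i : ~~ P i.
  have m0 : (0 < 4 * t' + 6)%N by lia.
  rewrite (divn_eq i (4 * t' + 6)) addnC.
  elim: (i %/ _)%N => [|k IH]; first by rewrite addn0; apply: (NP (Ordinal (ltn_pmod i m0))).
  by rewrite (mulSnr k) (addnA (i %% _)%N) Pm.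
rewrite -alt_geomE in xc.
apply: (@no_small_orbit q (alt_geom q t'.+1) (alt_geom q t') _ (gap3Z q t'.+1) t'
  q3' (D1 t') (AD t') erefl erefl (A_sub_D t') x c) => //.
- by move=> i; rewrite -anti; congr (x (i + _)%N); lia.
- by move=> i xi; have := NP i; rewrite /P xi eqxx.
- by move=> i xi; have := NP i; rewrite /P xi eqxx orbT.
Qed.

Lemma gap3Z_orbit j : (0 < j < 4 * t + 2)%N ->
  exists z k, z = U * q%:Z ^+ j + n * k /\ `|z| < U.
Proof.
case: t => [|t'] jt.
  have -> : j = 1%N by lia.
  by exists (q%:Z - 1), (-1); split; [rewrite /=; ring | rewrite /=; lia].
have Dq := alt_geomE q t'.
rewrite -alt_geomE.
apply: (witness_orbit q3' (D1 t') (AD t') erefl erefl (A_sub_D t') Dq); lia.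
Qed.

End Gap.

(** * Coset leaders *)

Section Cosets.
Local Open Scope nat_scope.
Variables (q m : nat).
Hypotheses (q3 : 3 <= q) (m0 : 0 < m).
Notation n := (q ^ m).+1.

Definition orb s i := s * q ^ i %% n.

Lemma orb_lt s i : orb s i < n. Proof. exact: ltn_pmod. Qed.

Lemma orb0 s : s < n -> orb s 0 = s. Proof. by move=> sn; rewrite /orb expn0 muln1 modn_small. Qed.

Lemma orb_orb s i j : orb (orb s i) j = orb s (i + j).
Proof. by rewrite /orb modnMml -mulnA -expnD. Qed.

Lemma orb_mul_period s N i k : orb s N = s -> orb s (i + k * N) = orb s i.
Proof.
by move=> sN; elim: k => [|k IH]; rewrite ?addn0 // mulSn addnCA -orb_orb sN IH.
Qed.

Lemma orb_anti s i : (orb s i + orb s (i + m)) %% n = 0.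
Proof.
rewrite /orb modnDm expnD mulnA -{1}[s * q ^ i]muln1 -mulnDr add1n.
exact: modnMl.
Qed.

Lemma orb_addm s i : 0 < orb s i -> orb s (i + m) = n - orb s i.
Proof.
move=> s0; have := orb_anti s i; have := orb_lt s i; have := orb_lt s (i + m).
move: s0; move: (orb s i) (orb s (i + m)) => a b a0 bn an.
move/eqP; rewrite -/(dvdn _ _) => /dvdnP[k]; case: k => [|[|k]]; lia.
Qed.

Lemma orb_period s i k : orb s (i + k * (2 * m)) = orb s i.
Proof.
have h : q ^ (2 * m) = 1 %[mod n].
  rewrite (_ : q ^ (2 * m) = (q ^ m - 1) * n + 1) ?modnMDl //.
  rewrite mul2n -addnn expnD.
  have : 0 < q ^ m by rewrite expn_gt0; lia.
  by case: (q ^ m) => // a _; rewrite subn1 /=; ring.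
rewrite /orb expnD mulnA [k * _]mulnC expnM -modnMmr -modnXm h modnXm.
by rewrite exp1n modnMmr muln1.
Qed.

(** The exponent [2 * m] qualifies and lies in the searched range, so the head is not the default
    0. *)
Lemma ordn_spec : 0 < ordn n q /\ q ^ ordn n q = 1 %[mod n].
Proof.
have h : 2 * m \in [seq k <- iota 1 n | q ^ k %% n == 1 %% n].
  rewrite mem_filter mem_iota; apply/andP; split.
    have := orb_period 1 0 1; rewrite /orb expn0 !mul1n => ->; exact: eqxx.
  have : m < 3 ^ m by apply: ltn_expl.
  have : 3 ^ m <= q ^ m by rewrite leq_exp2r.
  have : 2 * m <= 3 ^ m by elim: (m) => // k IH; rewrite expnS; lia.
  lia.
have : ordn n q \in [seq k <- iota 1 n | q ^ k %% n == 1 %% n].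
  by rewrite /ordn -nth0 mem_nth //; case: [seq _ <- _ | _] h.
by rewrite mem_filter mem_iota => /andP[/eqP-> /andP[]].
Qed.

Lemma orb_ordn s i k : orb s (i + k * ordn n q) = orb s i.
Proof.
have [_ h] := ordn_spec.
rewrite /orb expnD mulnA [k * _]mulnC expnM -modnMmr -modnXm h modnXm.
by rewrite exp1n modnMmr muln1.
Qed.

Lemma leaderP s : reflect (forall i, s <= orb s i) (is_coset_leader n q s).
Proof.
apply: (iffP allP) => [h i | h x /mapP[i _ ->]]; last exact: h.
have [d0 _] := ordn_spec.
rewrite (divn_eq i (ordn n q)) addnC orb_ordn; apply: h.
by apply/mapP; exists (i %% ordn n q) => //; rewrite mem_iota ltn_pmod.
Qed.

Lemma orb_inv i k : i < n -> orb (orb i k) (k * (2 * m - 1)) = i.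
Proof.
move=> i_n; rewrite orb_orb (_ : k + _ = 0 + k * (2 * m)) ?orb_period ?orb0 //.
by rewrite mulnBr muln1 add0n subnKC // leq_pmulr //; lia.
Qed.

Lemma leader_exists i : i < n -> exists k, is_coset_leader n q (orb i k).
Proof.
move=> i_n; have k0 : 0 < 2 * m by lia.
case: (arg_minnP (fun k : 'I_(2 * m) => orb i k) (P := xpredT) (i0 := Ordinal k0) isT).
move=> k _ kmin; exists k; apply/leaderP => j; rewrite orb_orb.
rewrite (divn_eq (k + j) (2 * m)) addnC orb_period.
exact: (kmin (Ordinal (ltn_pmod (k + j) k0))).
Qed.

Lemma leader_unique s s' k k' : s < n -> s' < n ->
  is_coset_leader n q s -> is_coset_leader n q s' -> orb s k = orb s' k' -> s = s'.
Proof.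
move=> sn s'n /leaderP ls /leaderP ls' e; apply/eqP; rewrite eqn_leq.
apply/andP; split; first by rewrite -[leqRHS](orb_inv k' s'n) -e orb_orb ls.
by rewrite -[leqRHS](orb_inv k sn) e orb_orb ls'.
Qed.

Definition has_period s N := [/\ 0 < N, orb s N = s & forall j, 0 < j < N -> orb s j <> s].

Lemma uniq_orbit s N : s < n -> has_period s N ->
  uniq [seq orb s j | j <- iota 0 N] /\
  forall x, x \in [seq orb s j | j <- iota 0 N] <-> exists k, x = orb s k.
Proof.
move=> sn [N0 sN sj].
split; last first.
  move=> x; split=> [/mapP[j _ ->]|[k ->]]; first by exists j.
  rewrite (divn_eq k N) addnC orb_mul_period //; apply/mapP; exists (k %% N) => //.
  by rewrite mem_iota ltn_pmod.
rewrite map_inj_in_uniq ?iota_uniq // => i j.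
rewrite !mem_iota !add0n /= => iN jN.
wlog ij : i j iN jN / i <= j.
  by move=> W e; case: (leqP i j) => [/W|/ltnW/W]; [apply|move=> W'; apply/esym/W'].
move=> e; apply/eqP/negP => /negP ne.
apply: (sj (j - i)); first lia.
rewrite -[RHS](orb_inv i sn) e orb_orb.
rewrite (_ : j + i * (2 * m - 1) = (j - i) + i * (2 * m)) ?orb_period //.
have : i <= i * (2 * m) by rewrite leq_pmulr //; lia.
by rewrite mulnBr muln1; lia.
Qed.

Variable h : nat.
Hypotheses (nh : n = 2 * h) (q_odd : odd q).

(** With [q ^ j = 2 w + 1] one has [h * q ^ j = w * n + h]: multiplication by the odd [q] fixes [h]
    modulo [n] and thus acts on deviations from [h] by plain multiplication. *)
Lemma orb_deviation (z k : int) u j : u < h ->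
  (z = u%:Z * q%:Z ^+ j + n%:Z * k)%R -> (`|z| < h%:Z)%R ->
  ((orb (h - u) j)%:Z = h%:Z - z)%R.
Proof.
move=> uh zE zh; have [w wE] : exists w, q ^ j = 2 * w + 1.
  exists (q ^ j)./2; have := odd_double_half (q ^ j); rewrite oddX q_odd orbT /=; lia.
rewrite /orb -modz_nat PoszM -subzn; last exact: ltnW.
rewrite (_ : _ * _ = (w%:Z + k) * n%:Z + (h%:Z - z))%R; last first.
  rewrite zE -!rmorphXn /= wE nh; lia.
rewrite modzMDl modz_small //; lia.
Qed.

(** The first [m] steps suffice, since the next [m] reflect the residues about [h]; hence the
    two-sided bound in the induction. *)
Lemma leader_of_deviation u : u < h ->
  (forall j, j < m -> exists z k : int,
     (z = u%:Z * q%:Z ^+ j + n%:Z * k)%R /\ (`|z| <= u%:Z)%R) ->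
  is_coset_leader n q (h - u).
Proof.
move=> uh zP; apply/leaderP => i; suff : h - u <= orb (h - u) i <= h + u by case/andP.
elim/ltn_ind: i => i IH; case: (ltnP i m) => im.
  have [z [k [zE zu]]] := zP _ im.
  have zh : (`|z| < h%:Z)%R by lia.
  have := orb_deviation uh zE zh; lia.
have lt_i : i - m < i by lia.
have := IH _ lt_i; have := @orb_addm (h - u) (i - m); rewrite subnK // nh; lia.
Qed.

Lemma leader_le_half s i : is_coset_leader n q s -> 0 < s -> s <= orb s i <= n - s.
Proof.
move/leaderP => ls s0; rewrite ls /=; have := ls (i + m); have := ls i => h1.
rewrite orb_addm; have := orb_lt s i; lia.
Qed.

Lemma orb_half i : orb h i = h.
Proof.
have h0 : 0 < h by lia.
have zE : (0 = 0%:Z * q%:Z ^+ i + n%:Z * 0 :> int)%R by rewrite mul0r mulr0.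
have := orb_deviation h0 zE; rewrite subn0 normr0 => /(_ _); lia.
Qed.

End Cosets.

Section SortedHead.
Local Open Scope nat_scope.

Lemma sorted_gtn_head (a : nat) (s : seq nat) : sorted gtn s -> a \in s ->
  (forall x, x \in s -> x <= a) ->
  exists s', [/\ s = a :: s', sorted gtn s' & forall x, (x \in s') = (x \in s) && (x != a)].
Proof.
case: s => // b s /=; rewrite path_sortedE; last by move=> x y z; lia.
case/andP=> /allP bs ss; rewrite inE => sa amax.
have ab : a = b.
  have := amax b (mem_head _ _); case/orP: sa => [/eqP //|/bs]; lia.
subst b; exists s; split=> // x; rewrite inE.
case: (eqVneq x a) => [->|_]; last by rewrite andbT.
by apply/negP => /bs; lia.
Qed.

End SortedHead.

(** * The largest coset leaders *)

Section Leaders.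
Local Open Scope nat_scope.
Variables (q t : nat).
Hypotheses (q3 : 3 <= q) (q_odd : odd q).
Notation m := (4 * t + 2).
Notation n := (q ^ m).+1.
Definition gap2 : nat := `|(q%:Z * alt_geom q%:Z t)%R|%N.
Definition gap3 : nat := `|gap3Z q t|%N.
Definition mid : nat := n./2.
Notation h := mid.

Let m0 : 0 < m. Proof. lia. Qed.
Let nZ : (n%:Z = q%:Z ^+ m + 1)%R. Proof. by rewrite -rmorphXn /= ; lia. Qed.

Lemma two_mid : n = 2 * h.
Proof. by rewrite /mid mul2n halfK /= oddX q_odd orbT subn0. Qed.

Let A1 : (1 <= alt_geom q%:Z t)%R. Proof. apply: alt_geom_ge1; lia. Qed.
Let gap2E : (gap2%:Z = q%:Z * alt_geom q%:Z t)%R.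
Proof. by rewrite /gap2 gez0_abs // mulr_ge0 //; lia. Qed.

Lemma gap2_gt0 : 0 < gap2.
Proof. rewrite -ltz_nat gap2E mulr_gt0 //; lia. Qed.

Let gap3E : (gap3%:Z = gap3Z q t)%R.
Proof. by have := gap2_lt_gap3Z t q3; rewrite /gap3; have := gap2E; lia. Qed.

Lemma gap2_lt_gap3 : gap2 < gap3.
Proof. by rewrite -ltz_nat gap2E gap3E gap2_lt_gap3Z. Qed.

Lemma gap3_lt_mid : gap3 < h.
Proof. have := gap3Z_lt_half t q3; rewrite -nZ -gap3E; have := two_mid; lia. Qed.

Let gap2_lt_mid : gap2 < h. Proof. exact: ltn_trans gap2_lt_gap3 gap3_lt_mid. Qed.

Notation d2 := (h - gap2).
Notation d3 := (h - gap3).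

(** As [n = (q ^ 2 + 1) * A], multiplication by [q ^ 2] negates the multiples of [A] modulo [n]: a
    cycle of length 4. *)
Lemma orb_gap2 j : j < 5 -> ((orb q m d2 j)%:Z =
   h%:Z - nth 0 [:: gap2%:Z; - alt_geom q%:Z t; - gap2%:Z; alt_geom q%:Z t; gap2%:Z] j)%R.
Proof.
have A_gap2 : (alt_geom q%:Z t <= gap2%:Z)%R by rewrite gap2E ler_peMl //; lia.
have := gap2_lt_mid; have := A1.
case: j => [|[|[|[|[|//]]]]] A1' qh _ /=.
- apply: (orb_deviation q3 m0 two_mid q_odd (k := 0)%R) => //; try lia.
- apply: (orb_deviation q3 m0 two_mid q_odd (k := -1)%R) => //; try lia.
  by rewrite nZ -alt_geomE gap2E; ring.
- apply: (orb_deviation q3 m0 two_mid q_odd (k := - q%:Z)%R) => //; try lia.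
  by rewrite nZ -alt_geomE gap2E; ring.
- apply: (orb_deviation q3 m0 two_mid q_odd (k := 1 - q%:Z ^+ 2)%R) => //; try lia.
  by rewrite nZ -alt_geomE gap2E; ring.
- apply: (orb_deviation q3 m0 two_mid q_odd (k := q%:Z - q%:Z ^+ 3)%R) => //; try lia.
  by rewrite nZ -alt_geomE gap2E; ring.
Qed.

Lemma orb_delta2_4 : orb q m d2 4 = d2.
Proof. by have := @orb_gap2 4 isT; have := gap2_lt_mid; rewrite /=; lia. Qed.

Lemma orb_delta2_neq j : 0 < j < 4 -> orb q m d2 j <> d2.
Proof.
have A_gap2 : (alt_geom q%:Z t < gap2%:Z)%R by rewrite gap2E ltr_pMl //; lia.
have := gap2_lt_mid; have := A1; have := @orb_gap2 j.
case: j => [|[|[|[|//]]]] //= /(_ isT); lia.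
Qed.

Lemma delta2_leader : is_coset_leader n q d2.
Proof.
have A_gap2 : (alt_geom q%:Z t <= gap2%:Z)%R by rewrite gap2E ler_peMl //; lia.
apply/(leaderP q3 m0) => i.
rewrite (divn_eq i 4) [_ + i %% 4]addnC (orb_mul_period _ _ orb_delta2_4).
have := ltn_pmod i (isT : 0 < 4).
have := gap2_lt_mid; have := A1; have := @orb_gap2 (i %% 4).
case: (i %% 4) => [|[|[|[|//]]]] //= /(_ isT); lia.
Qed.

Lemma gap3_orbit j : 0 < j < m ->
  exists z k : int, (z = gap3%:Z * q%:Z ^+ j + n%:Z * k /\ `|z| < gap3%:Z)%R.
Proof. by rewrite nZ gap3E; apply: gap3Z_orbit. Qed.

Lemma delta3_leader : is_coset_leader n q d3.
Proof.
apply: (leader_of_deviation q3 m0 two_mid q_odd gap3_lt_mid) => j jm.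
case: (posnP j) => [->|j0].
  by exists (Posz gap3), (Posz 0); split; [ring | lia].
have jm' : 0 < j < m by rewrite j0.
by have [z [k [zE zt]]] := gap3_orbit jm'; exists z, k; split=> //; lia.
Qed.

(** Strict maximality of the deviation settles the steps other than [m], through reflection beyond
    it; at step [m] the residue is [n - d3], on the other side of [h]. *)
Lemma orb_delta3_neq j : 0 < j < 2 * m -> orb q m d3 j <> d3.
Proof.
have d3n : d3 < n by have := two_mid; lia.
have th := gap3_lt_mid.
have lt_m i : 0 < i < m -> d3 < orb q m d3 i < n - d3.
  move=> im; have [z [k [zE zt]]] := gap3_orbit im.
  have zh : (`|z| < h%:Z)%R by lia.
  have := orb_deviation q3 m0 two_mid q_odd th zE zh; have := two_mid; lia.
case/andP=> j0 j2m; case: (ltnP j m) => jm.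
  by have := lt_m j; rewrite j0 jm => /(_ isT); lia.
have oj : orb q m d3 j = n - orb q m d3 (j - m).
  rewrite -{1}(subnK jm) orb_addm //.
  by have /leaderP := delta3_leader => /(_ q3 m0 (j - m)); lia.
case: (posnP (j - m)) => jm0; rewrite oj.
  by rewrite jm0 orb0 //; have := two_mid; have := gap2_lt_gap3; lia.
have jm' : 0 < j - m < m by lia.
by have := lt_m _ jm'; lia.
Qed.

Lemma mid_leader : is_coset_leader n q h.
Proof. by apply/(leaderP q3 m0) => i; rewrite (orb_half q3 m0 two_mid q_odd). Qed.

Lemma zero_leader : is_coset_leader n q 0.
Proof. by apply/(leaderP q3 m0). Qed.

(** The deviations of such an [s] form an orbit to which [small_orbit] applies; it meets that of [h]
    or [d2], and a coset has one leader. *)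
Lemma leader_gt_delta3 s : s < n -> is_coset_leader n q s -> d3 < s -> s = h \/ s = d2.
Proof.
move=> sn ls ds; have sP i := leader_le_half q3 m0 two_mid q_odd i ls.
have s0 : 0 < s by lia.
have hn := two_mid; have th := gap3_lt_mid; have qt := gap2_lt_gap3.
pose x i : int := (h%:Z - (orb q m s i)%:Z)%R.
have [i|i|i|i xi] := @small_orbit q t q3 x.
- apply/dvdzP; rewrite -nZ /x -[i.+1]addn1 -orb_orb {1}/orb expn1.
  (* The second term comes from [h - q * h = - (q / 2) * n], with [q / 2] rounded down. *)
  set y := orb q m s i; exists (((y * q) %/ n)%N%:Z - q./2%:Z)%R.
  have := divn_eq (y * q) n; move: (y * q %/ n) (y * q %% n) => a b.
  have := odd_double_half q; rewrite q_odd => /(congr1 (muln h)).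
  by move: (n) hn => _ -> qE yE; lia.
- have sPi := sP i s0; rewrite /x (orb_addm q3 m0); lia.
- suff : (`|h%:Z - (orb q m s i)%:Z| < gap3%:Z)%R by rewrite gap3E.
  have := sP i s0; lia.
rewrite -gap2E in xi.
have {}xi : orb q m s i = h \/ orb q m s i = d2 \/ orb q m s i = h + gap2.
  case: xi => xi; first by left; move: xi; rewrite /x; lia.
  have {}xi : (`|h%:Z - (orb q m s i)%:Z| = gap2%:Z)%R by [].
  by right; lia.
case: xi => xi.
  left; have hn' : h < n by lia.
  by apply: (leader_unique q3 m0 (k := i) (k' := 0) sn hn' ls mid_leader); rewrite orb0.
right; have [k kE] : exists k, orb q m s k = d2.
  case: xi => oE.
    by exists i.
  (* [m] more steps reflect [h + gap2] to [d2]. *)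
  by exists (i + m); rewrite (orb_addm q3 m0); lia.
have dn : d2 < n by lia.
by apply: (leader_unique q3 m0 (k := k) (k' := 0) sn dn ls delta2_leader); rewrite orb0.
Qed.

(** Having 0 in the tail ensures that the fourth entry is a genuine leader rather than a default
    value. *)
Lemma sorted_MinRep : exists L,
  [/\ sort geq (MinRep n q) = [:: h, d2, d3 & L], sorted gtn L, 0 \in L
    & forall x, x \in L = [&& x < n, is_coset_leader n q x & x < d3]].
Proof.
have hn := two_mid; have th := gap3_lt_mid; have qt := gap2_lt_gap3; have q0 := gap2_gt0.
pose M := sort geq (MinRep n q).
have MP x : (x \in M) = (x < n) && is_coset_leader n q x.
  by rewrite mem_sort mem_filter mem_iota add0n andbC.
have Ms : sorted gtn M.
  rewrite gtn_sorted_uniq_geq sort_uniq filter_uniq ?iota_uniq //=.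
  by apply: sort_sorted => x y; apply: leq_total.
have [|x|M1 [M1E M1s M1P]] := sorted_gtn_head (a := h) Ms.
- by rewrite MP mid_leader andbT; lia.
- rewrite MP => /andP[xn lx]; case: (posnP x) => [-> //|x0].
  by have := leader_le_half q3 m0 hn q_odd 0 lx x0; rewrite orb0 //; lia.
have [|x|M2 [M2E M2s M2P]] := sorted_gtn_head (a := d2) M1s.
- by rewrite M1P MP delta2_leader andbT; lia.
- rewrite M1P MP => /andP[/andP[xn lx] /eqP xh].
  by case: (leqP x d3) => [|/(leader_gt_delta3 xn lx)[]]; lia.
have [|x|M3 [M3E M3s M3P]] := sorted_gtn_head (a := d3) M2s.
- by rewrite M2P M1P MP delta3_leader andbT; lia.
- rewrite M2P M1P MP => /andP[/andP[/andP[xn lx] /eqP xh] /eqP xd].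
  by case: (leqP x d3) => [|/(leader_gt_delta3 xn lx)[]]; lia.
have M3' x : x \in M3 = [&& x < n, is_coset_leader n q x & x < d3].
  rewrite M3P M2P M1P MP; case: (boolP (x < n)) => //= xn.
  case: (boolP (is_coset_leader n q x)) => //= lx.
  case: (leqP x d3) => xd; first by lia.
  rewrite [x < d3]ltnNge (ltnW xd).
  by case: (leader_gt_delta3 xn lx xd) => ->; rewrite eqxx /= ?andbF.
exists M3; split=> //; first by rewrite -/M M1E M2E M3E.
by rewrite M3' zero_leader /=; lia.
Qed.

Lemma delta2E : delta_in q 2 n = d2.
Proof. by rewrite /delta_in; have [L [-> _ _ _]] := sorted_MinRep. Qed.

Lemma delta3E : delta_in q 3 n = d3.
Proof. by rewrite /delta_in; have [L [-> _ _ _]] := sorted_MinRep. Qed.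

Lemma delta4P : delta_in q 4 n < d3 /\
  forall x, x < n -> is_coset_leader n q x -> delta_in q 4 n < x -> x \in [:: h; d2; d3].
Proof.
rewrite /delta_in; have [L [-> Ls L0 LP]] := sorted_MinRep; rewrite /= -/(nth 0 L 0).
have [L1 L2] : nth 0 L 0 \in L /\ forall x, x \in L -> x <= nth 0 L 0.
  case: L Ls L0 {LP} => // a L /= Ls _; rewrite mem_head; split=> // x.
  rewrite inE => /orP[/eqP -> //|xL].
  have tr : transitive gtn by move=> y z w /=; lia.
  by move: Ls; rewrite (path_sortedE tr) => /andP[/allP/(_ _ xL) /= /ltnW].
split; first by move: L1; rewrite LP => /and3P[].
move=> x xn lx dx; case: (ltnP x d3) => [xd|].
  by have := L2 x; rewrite LP xn lx xd /= => /(_ isT); lia.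
rewrite leq_eqVlt => /orP[/eqP <-|xd]; first by rewrite !inE eqxx !orbT.
by case: (leader_gt_delta3 xn lx xd) => ->; rewrite !inE eqxx ?orbT.
Qed.

End Leaders.
Arguments mid q t : simpl never.

(** * Unions of cosets and their complements *)

Section OrbitUnion.
Local Open Scope nat_scope.
Variables (q m : nat).
Hypotheses (q3 : 3 <= q) (m0 : 0 < m).
Notation n := (q ^ m).+1.

Definition orbit_union (P : seq (nat * nat)) : seq nat :=
  flatten [seq [seq orb q m p.1 j | j <- iota 0 p.2] | p <- P].

Definition leaders_with_periods (P : seq (nat * nat)) : Prop :=
  uniq [seq p.1 | p <- P] /\ forall p, p \in P ->
    [/\ p.1 < n, is_coset_leader n q p.1 & has_period q m p.1 p.2].

Lemma orbit_unionP P : leaders_with_periods P ->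
  [/\ uniq (orbit_union P), size (orbit_union P) = sumn [seq p.2 | p <- P]
    & forall x, x \in orbit_union P <-> exists p k, p \in P /\ x = orb q m p.1 k].
Proof.
elim: P => [|p P IH] [uP PP].
  by split=> // x; split=> // -[p [k []]].
move: uP => /= /andP[pP uP].
have [|u1 s1 m1] := IH; first by split=> // p' p'P; apply: PP; rewrite inE p'P orbT.
have [pn lp pp] := PP p (mem_head _ _).
have [u2 m2] := uniq_orbit q3 m0 pn pp.
rewrite /orbit_union /= -/(orbit_union P); split.
- rewrite cat_uniq u1 u2 andbT /=; apply/hasPn => x /m1[p' [k [p'P ->]]].
  apply/negP => /m2[k' e]; move/negP: pP; apply; apply/mapP; exists p' => //.
  have [pn' lp' _] : [/\ p'.1 < n, is_coset_leader n q p'.1 & has_period q m p'.1 p'.2].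
    by apply: PP; rewrite inE p'P orbT.
  exact: (leader_unique q3 m0 pn pn' lp lp' (esym e)).
- by rewrite size_cat s1 size_map size_iota.
move=> x; rewrite mem_cat; split=> [/orP[/m2[k ->]|/m1[p' [k [p'P ->]]]]|].
- by exists p, k; rewrite mem_head.
- by exists p', k; rewrite inE p'P orbT.
case=> p' [k [+ ->]]; rewrite inE => /orP[/eqP->|p'P]; apply/orP.
  by left; apply/m2; exists k.
by right; apply/m1; exists p', k.
Qed.

(** Every leader outside [P] satisfies [R], so its coset is reached from [R]. Conversely an element
    of [R] lies below each nonzero leader of [P], the minimum of its coset, and avoids the coset of
    0 if that is in [P]. *)
Lemma orbit_union_compl P (R : pred nat) : leaders_with_periods P ->
  (forall s, s < n -> is_coset_leader n q s -> R s = (s \notin [seq p.1 | p <- P])) ->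
  (forall j, R j -> j < n /\ forall p, p \in P -> (p.1 = 0 /\ 0 < j) \/ j < p.1) ->
  forall i, i < n -> i \notin orbit_union P <-> exists j k, R j /\ i = orb q m j k.
Proof.
move=> lP RL RP i i_n; have [_ _ mP] := orbit_unionP lP; split.
  move/negP => iP; have [k lk] := leader_exists q3 m0 i_n.
  exists (orb q m i k), (k * (2 * m - 1)); rewrite orb_inv //; split=> //.
  rewrite RL ?orb_lt //; apply/mapP => -[p pP e].
  by apply: iP; apply/mP; exists p, (k * (2 * m - 1)); rewrite -e orb_inv.
case=> j [k [Rj ->]]; apply/negP => /mP[p [k' [pP e]]].
have [jn jP] := RP _ Rj; have [_ /(_ _ pP)[pn lp _]] := lP.
have {}e : j = orb q m p.1 (k' + k * (2 * m - 1)) by rewrite -orb_orb -e orb_inv.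
have : p.1 <= j by rewrite e; apply/(leaderP q3 m0).
case: (jP _ pP) => [[p0 j0]|]; last by lia.
by move: e; rewrite p0 /orb mul0n mod0n; lia.
Qed.

End OrbitUnion.

(** * Exponents of the nonzeros of the codes *)

Section NonZeros.
Local Open Scope nat_scope.
Variables (q t : nat).
Hypotheses (q3 : 3 <= q) (q_odd : odd q).
Notation m := (4 * t + 2).
Notation n := (q ^ m).+1.

Let m0 : 0 < m. Proof. lia. Qed.

Lemma zero_period : has_period q m 0 1.
Proof. by split=> [||j]; rewrite ?/orb ?mul0n ?mod0n //; lia. Qed.

Lemma mid_period : has_period q m (mid q t) 1.
Proof. by split=> [||j]; rewrite ?(orb_half q3 m0 (two_mid t q_odd) q_odd) //; lia. Qed.

Lemma delta2_period : has_period q m (delta_in q 2 n) 4.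
Proof.
rewrite delta2E //; split=> //; first exact: orb_delta2_4.
by move=> j; apply: orb_delta2_neq.
Qed.

Lemma delta3_period : has_period q m (delta_in q 3 n) (2 * m).
Proof.
have h := two_mid t q_odd.
rewrite delta3E //; split=> //; first by lia.
  rewrite -[2 * m]mul1n -[1 * _]add0n orb_period // orb0 //; lia.
by move=> j; apply: orb_delta3_neq.
Qed.

(* Each leader comes with the size of its coset. *)
Definition top_leaders : seq (nat * nat) :=
  [:: (0, 1); (mid q t, 1); (delta_in q 2 n, 4); (delta_in q 3 n, 2 * m)].

Lemma top_leaders_order :
  [/\ delta_in q 4 n < delta_in q 3 n, 0 < delta_in q 3 n,
      delta_in q 3 n < delta_in q 2 n, delta_in q 2 n < mid q t & mid q t < n].
Proof.
have h := two_mid t q_odd; have qt := gap2_lt_gap3 t q3; have th := gap3_lt_mid t q3 q_odd.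
have q0 := gap2_gt0 t q3; have [d4 _] := delta4P t q3 q_odd.
by split; rewrite // ?delta3E ?delta2E //; lia.
Qed.

Lemma top_leaders_periods z k :
  leaders_with_periods q m (drop z (take k top_leaders)).
Proof.
have [_ d3_0 d23 d2h hn] := top_leaders_order.
have uP : uniq [seq p.1 | p <- top_leaders].
  by rewrite /= !inE; lia.
split; first by rewrite map_drop map_take drop_uniq // take_uniq.
move=> p /mem_drop/mem_take; rewrite !inE => /or4P[] /eqP -> /=.
- by split; [lia | exact: zero_leader | exact: zero_period].
- by split; [lia | exact: mid_leader | exact: mid_period].
- by split; [lia | rewrite delta2E //; exact: delta2_leader | exact: delta2_period].
- by split; [lia | rewrite delta3E //; exact: delta3_leader | exact: delta3_period].
Qed.

(** [b] is the first exponent of the defining range: for [b = 0] the exponent 0 becomes a zero of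
    the code, so [drop] removes its coset from the nonzeros. *)
Lemma bch_zeros (b : bool) k delta :
  (k = 3 /\ delta_in q 3 n < delta <= delta_in q 2 n) \/
  (k = 4 /\ delta_in q 4 n < delta <= delta_in q 3 n) ->
  let Z := orbit_union q m (drop (~~ b) (take k top_leaders)) in
  forall i, i < n -> i \notin Z <-> exists j e, b <= j < delta /\ i = orb q m j e.
Proof.
move=> kd; have [d43 d3_0 d23 d2h hn] := top_leaders_order.
apply: (orbit_union_compl q3 m0 (R := fun j => b <= j < delta)).
- exact: top_leaders_periods.
- move=> s sn ls.
  have top : delta_in q 4 n < s -> s \in [:: mid q t; delta_in q 2 n; delta_in q 3 n].
    have [_ /(_ s sn ls)] := delta4P t q3 q_odd.
    by rewrite -(delta2E t q3 q_odd) -(delta3E t q3 q_odd).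
  move: top kd; rewrite /top_leaders !inE => top [[-> kd]|[-> kd]]; case: b; rewrite /= !inE;
    (case: (ltnP s delta) => sd; [lia | have : delta_in q 4 n < s by lia]);
    by move/top; lia.
- move=> j /andP[bj jd]; split; first by lia.
  move=> p; case: kd => -[-> kd]; case: b bj => bj; rewrite /= !inE.
  + by case/or3P => /eqP -> /=; lia.
  + by case/orP => /eqP -> /=; lia.
  + by case/or4P => /eqP -> /=; lia.
  + by case/or3P => /eqP -> /=; lia.
Qed.

End NonZeros.

(** * Cyclic codes *)

Lemma dvdp_lcmp (K : fieldType) (p r w : {poly K}) : p != 0 ->
  (lcmp p r %| w) = (p %| w) && (r %| w).
Proof.
move=> p0; set g := gcdp p r.
have g0 : g != 0 by rewrite gcdp_eq0 negb_and p0.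
pose p' := p %/ g; pose r' := r %/ g.
have pE : p = p' * g by rewrite divpK ?dvdp_gcdl.
have rE : r = r' * g by rewrite divpK ?dvdp_gcdr.
have p'0 : p' != 0 by apply: contraNneq p0 => e; rewrite pE e mul0r.
have cop : coprimep p' r' by apply: coprimep_div_gcd; rewrite p0.
have -> : lcmp p r = p' * r' * g.
  rewrite /lcmp -/g {1}pE {1}rE.
  by rewrite (_ : p' * g * (r' * g) = p' * r' * g * g) ?mulpK //; ring.
apply/idP/andP => [h|[pw rw]].
  by split; apply: dvdp_trans h; rewrite ?pE ?rE; apply/dvdpP; [exists r' | exists p']; ring.
have gw : g %| w by apply: dvdp_trans pw; apply: dvdp_gcdl.
rewrite -(divpK gw) dvdp_mul2r // Gauss_dvdp //.
by rewrite -(dvdp_mul2r p' _ g0) -(dvdp_mul2r r' _ g0) -pE -rE divpK // pw.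
Qed.

Lemma dvdp_big_lcmp (K : fieldType) (I : Type) (s : seq I) (P : I -> {poly K}) w :
  (forall i, P i != 0) ->
  (\big[@lcmp K/1]_(i <- s) P i %| w) = all (fun i => P i %| w) s.
Proof.
move=> P0; elim: s => [|i s IH]; first by rewrite big_nil dvd1p.
by rewrite big_cons dvdp_lcmp // IH.
Qed.

(** * The Frobenius map and descent to the base field *)

Section Frobenius.
Variables (F : finFieldType) (L : fieldExtType F).
Notation q := #|F|.
Notation lift := (map_poly (in_alg L)).

Definition frob (x : L) : L := x ^+ q.

Lemma frob_is_zmod_morphism : zmod_morphism frob.
Proof.
have [p p_pr charFp] := finPcharP F.
have qp : [pchar L].-nat q.
  rewrite (card_pprimeChar charFp); apply: (sub_in_pnat (pi := p)) => [r _ /eqnP ->|].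
    by rewrite (fmorph_pchar (in_alg L)).
  by rewrite pnatX pnat_id.
by move=> x y; rewrite /frob exprDn_pchar // exprNn_pchar.
Qed.

Lemma frob_is_monoid_morphism : monoid_morphism frob.
Proof. by split=> [|x y]; rewrite /frob ?expr1n ?exprMn. Qed.

HB.instance Definition _ := GRing.isZmodMorphism.Build L L frob frob_is_zmod_morphism.
HB.instance Definition _ := GRing.isMonoidMorphism.Build L L frob frob_is_monoid_morphism.

Lemma frob_in_alg (a : F) : frob (in_alg L a) = in_alg L a.
Proof. by rewrite /frob -rmorphXn expf_card. Qed.

Lemma lift_frob (w : {poly F}) (x : L) : (lift w).[frob x] = frob (lift w).[x].
Proof.
rewrite -horner_map /= -map_poly_comp; congr (_.[_]).
by apply: eq_map_poly => a /=; rewrite frob_in_alg.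
Qed.

Lemma lift_root_expq (w : {poly F}) (x : L) e :
  root (lift w) x -> root (lift w) (x ^+ (q ^ e)).
Proof.
move=> wx; elim: e => [|e IH]; first by rewrite expn0 expr1.
by rewrite expnSr exprM rootE -/(frob _) lift_frob (rootP IH) rmorph0.
Qed.

(** Frobenius is injective, hence permutes [rs] and fixes the coefficients of the product; its fixed
    points are the elements of [F]. *)
Lemma prod_XsubC_descent (rs : seq L) : uniq rs -> {in rs, forall z, frob z \in rs} ->
  exists g : {poly F}, lift g = \prod_(z <- rs) ('X - z%:P).
Proof.
move=> u_rs rsF; suff /polyOver1P[g ->] : \prod_(z <- rs) ('X - z%:P) \is a polyOver 1%VS.
  by exists g.
have perm : perm_eq (map frob rs) rs.
  have uF : uniq (map frob rs) by rewrite map_inj_uniq //; apply: fmorph_inj.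
  have [|_ e] := uniq_min_size uF _ (eq_leq (esym (size_map frob rs))).
    by move=> _ /mapP[z /rsF zr ->].
  exact: uniq_perm.
apply/polyOverP => i; rewrite Fermat's_little_theorem dimv1 expn1 -/(frob _).
suff e : map_poly frob (\prod_(z <- rs) ('X - z%:P)) = \prod_(z <- rs) ('X - z%:P).
  by apply/eqP; rewrite -[in LHS]coef_map /= e.
transitivity (\prod_(z <- map frob rs) ('X - z%:P)); last exact: perm_big.
rewrite rmorph_prod big_map; apply: eq_bigr => z _.
by rewrite rmorphB /= map_polyX map_polyC.
Qed.

End Frobenius.

(** * Zeros, dimension and weights *)

Section Codes.
Variables (F : finFieldType) (L : fieldExtType F) (n : nat) (beta : L).
Hypothesis beta_prim : n.-primitive_root beta.
Notation q := #|F|.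
Notation lift := (map_poly (in_alg L)).

Lemma mem_BCH (delta b : nat) (c : 'rV[F]_n) :
  reflect (forall i, (b <= i < b + delta.-1)%N -> root (lift (word_poly c)) (beta ^+ i))
    (c \in BCH n beta delta b).
Proof.
rewrite inE /gen_poly dvdp_big_lcmp => [|i]; last exact: monic_neq0 (monic_minPoly _ _).
apply: (iffP allP) => h i.
  move=> bi; have := h i; rewrite mem_index_iota => /(_ bi) /dvdpP[k ->].
  by rewrite rootM root_minPoly orbT.
rewrite mem_index_iota => /h; apply: minPoly_dvdp.
by apply/polyOver1P; exists (word_poly c).
Qed.

Lemma word_polyE (c : 'rV[F]_n) : word_poly c = rVpoly c.
Proof.
rewrite /word_poly /rVpoly poly_def; apply: eq_bigr => i _.
by rewrite valK mul_polyC.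
Qed.

(** [C] consists of the multiples of a [g] over [F] with root set [rs]; counting the cofactors gives
    its cardinality, hence its dimension. *)
Lemma code_dimE (C : {set 'rV[F]_n}) (rs : seq L) :
  uniq rs -> {in rs, forall z, frob z \in rs} -> (size rs <= n)%N ->
  (forall c, (c \in C) = all (root (lift (word_poly c))) rs) ->
  code_dim C = (n - size rs)%N.
Proof.
move=> u_rs rsF rsn CE; have [g gE] := prod_XsubC_descent u_rs rsF.
have {}CE c : (c \in C) = (g %| rVpoly c).
  rewrite CE -(dvdp_map (in_alg L)) gE -word_polyE; apply/idP/idP => [h|/dvdpP[k ->]].
    by apply: uniq_roots_dvdp => //; rewrite uniq_rootsE.
  by apply/allP => z zr; rewrite rootM root_prod_XsubC zr orbT.
have size_g : size g = (size rs).+1 by rewrite -(size_map_poly (in_alg L)) gE size_prod_XsubC.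
have g0 : g != 0 by rewrite -size_poly_eq0 size_g.
(* [code_dim] measures the span, so [C] must first be seen to be its own span. *)
have spanE v : (v \in <<enum C>>%VS) = (v \in C).
  apply/idP/idP => [vC|vC]; last by rewrite memv_span // mem_enum.
  rewrite (coord_span vC) CE; elim/big_ind: _ => [|x y gx gy|i _].
  - by rewrite linear0 dvdp0.
  - by rewrite linearD dvdp_add.
  have [->|a0] := eqVneq (coord (enum_tuple C) i v) 0; first by rewrite scale0r linear0 dvdp0.
  rewrite linearZ dvdpZr // -CE -[_ \in C]mem_enum.
  by rewrite mem_nth // -cardE.
have cardC : #|C| = (q ^ (n - size rs))%N.
  pose f (h : 'rV[F]_(n - size rs)) : 'rV[F]_n := poly_rV (g * rVpoly h).
  have szf (h : 'rV[F]_(n - size rs)) : (size (g * rVpoly h)%R <= n)%N.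
    apply: leq_trans (size_polyMleq _ _) _; rewrite size_g addSn /=.
    by rewrite -[leqRHS](subnKC rsn) leq_add2l; apply: size_poly.
  have f_inj : injective f.
    move=> h h' /(congr1 rVpoly); rewrite !poly_rV_K // => /(mulfI g0) e.
    by rewrite -[h]rVpolyK e rVpolyK.
  have -> : C = f @: setT.
    apply/setP => c; rewrite CE; apply/dvdpP/imsetP => [[k kE]|[h _ ->]].
      exists (poly_rV k); rewrite ?inE // /f poly_rV_K; first by rewrite mulrC -kE rVpolyK.
      have [->|k0] := eqVneq k 0; first by rewrite size_poly0.
      have : (size (rVpoly c) <= n)%N by exact: size_poly.
      by rewrite kE size_mul // size_g addnS /= leq_subRL // addnC.
    by exists (rVpoly h); rewrite poly_rV_K // mulrC.
  by rewrite card_imset // cardsT card_mx mul1n.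
have : (q ^ code_dim C = q ^ (n - size rs))%N.
  by rewrite -cardC /code_dim -card_vspace; apply: eq_card => v; rewrite spanE.
by move/eqP; rewrite eqn_exp2l ?finNzRing_gt1 // => /eqP.
Qed.

Hypothesis n_gt0 : (0 < n)%N.

Lemma beta_neq0 : beta != 0.
Proof.
apply/eqP => b0; have := prim_expr_order beta_prim.
by rewrite b0 expr0n (gtn_eqF n_gt0) => /eqP; rewrite eq_sym oner_eq0.
Qed.

Lemma horner_word (c : 'rV[F]_n) (z : L) :
  (lift (word_poly c)).[z] = \sum_(i < n) in_alg L (c ord0 i) * z ^+ i.
Proof.
rewrite /word_poly rmorph_sum /= horner_sum; apply: eq_bigr => i _.
by rewrite rmorphM /= map_polyC map_polyXn hornerCM hornerXn.
Qed.

(* Pair the word with the polynomial that vanishes on its support but for one point. *)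
Lemma bch_bound (c : 'rV[F]_n) (a D : nat) : c != 0 ->
  (forall i, (i < D)%N -> root (lift (word_poly c)) (beta ^+ (a + i))) -> (D < wt c)%N.
Proof.
move=> c0 cz; rewrite ltnNge; apply/negP => wD.
have [i0 ci0] : exists i, c ord0 i != 0.
  apply/existsP; apply: contraNT c0; rewrite negb_exists => /forallP c0.
  by apply/eqP/rowP => i; rewrite mxE; apply/eqP; rewrite -[_ == _]negbK.
pose S := enum ([set i | c ord0 i != 0] :\ i0).
pose p : {poly L} := \prod_(i <- S) ('X - (beta ^+ i)%:P).
have sz_p : (size p <= D)%N.
  rewrite /p size_prod_XsubC -cardE; apply: leq_trans wD.
  have i0S : i0 \in [set i | c ord0 i != 0] by rewrite inE.
  by rewrite /wt [leqRHS](cardsD1 i0) i0S.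
have p_i0 : p.[beta ^+ i0] != 0.
  apply/negP; rewrite -[_ == _]/(root p _) /p.
  rewrite -(big_map (fun i : 'I_n => beta ^+ i) xpredT (fun z => 'X - z%:P)) root_prod_XsubC.
  case/mapP => i; rewrite mem_enum !inE => /andP[/eqP i_i0 _] /eqP.
  rewrite (eq_prim_root_expr beta_prim) !modn_small // => /eqP/val_inj e.
  by apply: i_i0.
have p_S i : c ord0 i != 0 -> i != i0 -> p.[beta ^+ i] = 0.
  move=> ci ii0; apply/rootP.
  rewrite /p -(big_map (fun i : 'I_n => beta ^+ i) xpredT (fun z => 'X - z%:P)) root_prod_XsubC.
  by apply/mapP; exists i; rewrite // mem_enum !inE ii0.
have : \sum_(i < n) in_alg L (c ord0 i) * beta ^+ (a * i) * p.[beta ^+ i] = 0.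
  under eq_bigr => i _ do rewrite horner_coef mulr_sumr.
  rewrite exchange_big big1 //= => k _.
  have kD : (k < D)%N by apply: leq_trans sz_p.
  have /rootP := cz k kD; rewrite horner_word => e.
  transitivity (p`_k * \sum_(i < n) in_alg L (c ord0 i) * (beta ^+ (a + k)) ^+ i);
    last by rewrite e mulr0.
  rewrite mulr_sumr; apply: eq_bigr => i _; rewrite -!exprM mulnDl exprD [(k * i)%N]mulnC.
  by rewrite mulrCA -mulrA.
rewrite (bigD1 i0) //= big1 ?addr0 => [/eqP|i ii0]; last first.
  have [->|ci] := eqVneq (c ord0 i) 0; first by rewrite scale0r !mul0r.
  by rewrite p_S // mulr0.
by rewrite !mulf_eq0 (negPf p_i0) scaler_eq0 oner_eq0 (negPf ci0) expf_eq0 (negPf beta_neq0) andbF.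
Qed.

End Codes.

(** * Complementary duals from reversibility *)

Section LCD.
Variables (F : finFieldType) (L : fieldExtType F) (n' : nat) (beta : L).
Notation n := n'.+1.
Hypothesis beta_prim : n.-primitive_root beta.
Notation lift := (map_poly (in_alg L)).

(** Indices are subtracted modulo [n]: this is the reversed word, cyclically shifted. *)
Definition rev_shift (k : 'I_n) (c : 'rV[F]_n) : 'rV[F]_n := \row_i c ord0 (k - i).

Lemma root1_expD (z : L) (i j : 'I_n) : z ^+ n = 1 -> z ^+ (i + j)%R = z ^+ i * z ^+ j.
Proof. by move=> zn; rewrite /= expr_mod // exprD. Qed.

Lemma horner_rev_shift (k : 'I_n) (c : 'rV[F]_n) (z : L) : z ^+ n = 1 ->
  (lift (word_poly (rev_shift k c))).[z] = z ^+ k * (lift (word_poly c)).[z^-1].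
Proof.
move=> zn; rewrite !horner_word mulr_sumr (reindex_inj (subrI k)).
have z0 : z != 0 by apply/eqP => z0; move/eqP: zn; rewrite z0 expr0n eq_sym oner_eq0.
apply: eq_bigr => i _; rewrite mxE subKr mulrCA; congr (_ * _).
apply: (mulIf (expf_neq0 i z0)); rewrite -root1_expD // subrK exprVn -mulrA mulVf ?mulr1 //.
exact: expf_neq0.
Qed.

(* [dotv c (rev_shift k c)] is a coefficient of the cyclic square of [c], so the
   value of [c] at [z] has square 0. *)
Lemma convolution_root (c : 'rV[F]_n) (z : L) : z ^+ n = 1 ->
  (forall k, dotv c (rev_shift k c) = 0) -> root (lift (word_poly c)) z.
Proof.
move=> zn ck; rewrite rootE -[_ == 0]orbb -mulf_eq0.
transitivity (\sum_(k < n) in_alg L (dotv c (rev_shift k c)) * z ^+ k == 0); last first.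
  by apply/eqP; rewrite big1 // => k _; rewrite ck rmorph0 mul0r.
congr (_ == 0); under [RHS]eq_bigr => k _ do rewrite rmorph_sum mulr_suml.
rewrite exchange_big horner_word mulr_suml; apply: eq_bigr => i _.
rewrite mulr_sumr [RHS](reindex_inj (addIr i)); apply: eq_bigr => k _.
rewrite rmorphM mxE addrK root1_expD // [z ^+ _ * z ^+ _]mulrC.
by rewrite !mulrA; congr (_ * _); rewrite -!mulrA; congr (_ * _); rewrite mulrC.
Qed.

Lemma word_eq0 (c : 'rV[F]_n) :
  (forall i, root (lift (word_poly c)) (beta ^+ i)) -> c = 0.
Proof.
move=> c_root; have : lift (word_poly c) = 0.
  apply: (roots_geq_poly_eq0 (rs := [seq beta ^+ i | i <- iota 0 n])).
  - by apply/allP => _ /mapP[i _ ->].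
  - rewrite map_inj_in_uniq ?iota_uniq // => i j.
    rewrite !mem_iota !add0n /= => i_n j_n /eqP.
    by rewrite (eq_prim_root_expr beta_prim) !modn_small // => /eqP.
  by rewrite size_map size_iota size_map_poly word_polyE; apply: size_poly.
move/eqP; rewrite map_poly_eq0 word_polyE => /eqP c0.
by rewrite -[c]rVpolyK c0 linear0.
Qed.

(** A word of [C] in the dual is orthogonal to its own reversed shifts, so it vanishes at all [n]-th
    roots of unity. *)
Lemma LCD_of_rev_shift (C : {set 'rV[F]_n}) : 0 \in C ->
  (forall k c, c \in C -> rev_shift k c \in C) -> is_LCD C.
Proof.
move=> C0 Crev; apply/setP => c; rewrite !inE; apply/andP/eqP => [[cC /forall_inP cd]|->].
  apply: word_eq0 => i; apply: convolution_root => [|k]; last by apply/eqP/cd/Crev.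
  by rewrite exprAC (prim_expr_order beta_prim) expr1n.
split=> //; apply/forall_inP => d _.
by apply/eqP/big1 => i _; rewrite mxE mul0r.
Qed.

End LCD.

(** * Closure of the zeros under inversion *)

Section BCHReversible.
Variables (F : finFieldType) (L : fieldExtType F) (m : nat) (beta : L).
Notation q := #|F|.
Notation n := (q ^ m).+1.
Hypothesis beta_prim : n.-primitive_root beta.
Notation lift := (map_poly (in_alg L)).

(** [m] Frobenius steps raise to the power [q ^ m], which is -1 modulo [n]. *)
Lemma lift_rootV (w : {poly F}) i :
  root (lift w) (beta ^+ i) -> root (lift w) (beta ^- i).
Proof.
move/(lift_root_expq m); congr (root _ _).
have bi0 : beta ^+ i != 0 by rewrite expf_neq0 // (beta_neq0 beta_prim).
apply: (mulIf bi0); rewrite mulVf // -exprSr exprAC (prim_expr_order beta_prim).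
by rewrite expr1n.
Qed.

Lemma BCH_LCD delta b : is_LCD (BCH n beta delta b).
Proof.
apply: (LCD_of_rev_shift beta_prim) => [|k c /mem_BCH cC]; apply/mem_BCH => i ib.
  by rewrite rootE horner_word big1 // => j _; rewrite mxE rmorph0 mul0r.
rewrite rootE horner_rev_shift ?(rootP (lift_rootV (cC i ib))) ?mulr0 //.
by rewrite exprAC (prim_expr_order beta_prim) expr1n.
Qed.

End BCHReversible.

(** * Parameters of the codes *)

Section TopCodes.
Variables (F : finFieldType) (L : fieldExtType F) (t : nat) (beta : L).
Notation q := #|F|.
Notation m := (4 * t + 2)%N.
Notation n := (q ^ m).+1.
Hypotheses (q_odd : odd q) (beta_prim : n.-primitive_root beta).

Let q3 : (3 <= q)%N.
Proof. by move: (finNzRing_gt1 F) q_odd; case: #|F| => [|[|[|]]]. Qed.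

Let m0 : (0 < m)%N. Proof. by lia. Qed.

Lemma expr_orb j e : beta ^+ orb q m j e = beta ^+ j ^+ (q ^ e).
Proof. by rewrite /orb (expr_mod _ (prim_expr_order beta_prim)) exprM. Qed.

(* Covers both the distance [delta] for [b = 1] and [delta + 1] for [b = 0]. *)
Lemma BCH_dim (b : bool) k delta :
  (k = 3 /\ delta_in q 3 n < delta <= delta_in q 2 n)%N \/
  (k = 4 /\ delta_in q 4 n < delta <= delta_in q 3 n)%N ->
  code_dim (BCH n beta (delta + ~~ b) b) =
    sumn [seq p.2 | p <- drop (~~ b) (take k (top_leaders q t))].
Proof.
move=> kd; have [d43 d3_0 d23 d2h hn] := top_leaders_order t q3 q_odd.
have ZP := bch_zeros q3 q_odd b kd; rewrite /= in ZP.
have [uZ sZ mZ] := orbit_unionP q3 m0 (top_leaders_periods t q3 q_odd (~~ b) k).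
rewrite -sZ; set Z := orbit_union _ _ _ in ZP uZ mZ *.
have Zn x : x \in Z -> (x < n)%N by case/mZ => p [e [_ ->]]; apply: orb_lt.
(* The exponents of the zeros: the dimension is [n - size E = size Z]. *)
pose E := [seq i <- iota 0 n | i \notin Z].
have memE i : (i \in E) = (i < n)%N && (i \notin Z).
  by rewrite mem_filter mem_iota add0n andbC.
have range i : (b <= i < b + (delta + ~~ b).-1)%N = (b <= i < delta)%N.
  by case: (b) kd => -[]; lia.
have sE : size E = (n - size Z)%N.
  have <- : size [seq i <- iota 0 n | i \in Z] = size Z.
    apply/perm_size/uniq_perm => //; first by rewrite filter_uniq ?iota_uniq.
    by move=> i; rewrite mem_filter mem_iota add0n; case: (boolP (i \in Z)) => // /Zn ->.
  have := count_predC [in Z] (iota 0 n); rewrite size_iota => e.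
  by rewrite !size_filter -[X in (X - _)%N]e addKn.
have sZn : (size Z <= n)%N.
  rewrite -(size_iota 0 n); apply: uniq_leq_size => // x /Zn xn.
  by rewrite mem_iota.
have kdn i : (i < delta)%N -> (i < n)%N by lia.
rewrite (@code_dimE _ _ _ _ [seq beta ^+ i | i <- E]) ?size_map ?sE.
- by rewrite subKn.
- rewrite map_inj_in_uniq ?filter_uniq ?iota_uniq // => i j.
  rewrite !memE => /andP[i_n _] /andP[j_n _] /eqP.
  by rewrite (eq_prim_root_expr beta_prim) !modn_small // => /eqP.
- move=> _ /mapP[i + ->]; rewrite memE => /andP[i_n /(ZP _ i_n)[j [e [jd iE]]]].
  apply/mapP; exists (orb q m j e.+1).
    by rewrite memE orb_lt /=; apply/ZP; [exact: orb_lt | exists j, e.+1].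
  by rewrite /frob iE !expr_orb -exprM -expnSr.
- exact: leq_subr.
move=> c; apply/mem_BCH/allP => [cP _ /mapP[i + ->] | cP j].
  rewrite memE => /andP[i_n /(ZP _ i_n)[j [e [jd ->]]]].
  by rewrite expr_orb; apply/lift_root_expq/cP; rewrite range.
rewrite range => jd; have jn : (j < n)%N by apply: kdn; case/andP: jd.
apply: cP; apply/mapP; exists j => //; rewrite memE jn /=.
by apply/(ZP _ jn); exists j, 0%N; rewrite orb0.
Qed.

Lemma BCH1_dist delta D : (D < delta)%N -> min_dist_ge (BCH n beta delta 1) D.
Proof.
move=> Dd c /mem_BCH cP c0; apply/ltnW/(bch_bound beta_prim _ (a := 1) c0) => // i iD.
by apply: cP; lia.
Qed.

(** The zeros with exponents up to [D] and their inverses contain the [2 * D] consecutive exponents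
    from [- D] to [D - 1]; the run starts at [n - D] to stay in [nat]. *)
Lemma BCH0_dist delta D : (D < delta < n)%N -> min_dist_ge (BCH n beta delta.+1 0) (2 * D).
Proof.
move=> Dd c /mem_BCH cP c0; apply/ltnW/(bch_bound beta_prim _ (a := n - D) c0) => // i iD.
case: (ltnP i D) => [iltD|Dlei].
  have -> : beta ^+ (n - D + i) = beta ^- (D - i).
    have bD : beta ^+ (D - i) != 0 by rewrite expf_neq0 // (beta_neq0 beta_prim).
    apply: (mulIf bD); rewrite mulVf // -exprD -(prim_expr_order beta_prim).
    by congr (_ ^+ _); lia.
  by apply: (lift_rootV beta_prim); apply: cP; lia.
have -> : beta ^+ (n - D + i) = beta ^+ (i - D).
  rewrite -[RHS]mul1r -(prim_expr_order beta_prim) -exprD; congr (_ ^+ _); lia.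
by apply: cP; lia.
Qed.

End TopCodes.

Theorem theorem2 (F : finFieldType) (q t : nat) (L : fieldExtType F) (beta : L) :
  #|F| = q -> odd q ->
  let m := (4 * t + 2)%N in
  let n := (q ^ m).+1 in
  n.-primitive_root beta ->
  (forall delta : nat,
     (delta_in q 3 n + 1 <= delta <= delta_in q 2 n)%N ->
     is_LCD (BCH n beta delta 1) /\
     has_params (BCH n beta delta 1) 6 (delta_in q 3 n)) /\
  (forall delta : nat,
     (delta_in q 4 n + 1 <= delta <= delta_in q 3 n)%N ->
     is_LCD (BCH n beta delta 1) /\
     has_params (BCH n beta delta 1) (2 * m + 6) (delta_in q 4 n)) /\
  (forall delta : nat,
     (delta_in q 3 n + 1 <= delta <= delta_in q 2 n)%N ->
     is_LCD (BCH n beta delta.+1 0) /\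
     has_params (BCH n beta delta.+1 0) 5 (2 * delta_in q 3 n)) /\
  (forall delta : nat,
     (delta_in q 4 n + 1 <= delta <= delta_in q 3 n)%N ->
     is_LCD (BCH n beta delta.+1 0) /\
     has_params (BCH n beta delta.+1 0) (2 * m + 5) (2 * delta_in q 4 n)).
Proof.
move=> <- q_odd m n beta_prim.
have q3 : (3 <= #|F|)%N by move: (finNzRing_gt1 F) q_odd; case: #|F| => [|[|[|]]].
have [d43 d3_0 d23 d2h hn] := top_leaders_order t q3 q_odd.
split; [|split; [|split]] => delta; rewrite addn1 => dP;
  (split; [exact: (BCH_LCD beta_prim) | split]).
- by have := BCH_dim q_odd beta_prim true (or_introl (conj erefl dP)); rewrite addn0.
- by apply: BCH1_dist => //; case/andP: dP.
- have := BCH_dim q_odd beta_prim true (or_intror (conj erefl dP)).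
  by rewrite addn0 /= => ->; rewrite /m; lia.
- by apply: BCH1_dist => //; case/andP: dP.
- by have := BCH_dim q_odd beta_prim false (or_introl (conj erefl dP)); rewrite addn1.
- by apply: BCH0_dist => //; move: dP d2h hn; rewrite /n /m; lia.
- have := BCH_dim q_odd beta_prim false (or_intror (conj erefl dP)).
  by rewrite addn1 /= => ->; rewrite /m; lia.
- by apply: BCH0_dist => //; move: dP d23 d2h hn; rewrite /n /m; lia.
Qed.
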